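(* Let $p\equiv 1\pmod 8$ be a prime number that is a congruent number, and let $E_p/\mathbb{Q}$ be the elliptic curve $y^2=x^3-p^2x$. If $E_p/\mathbb{Q}$ has rank $2$ (or equivalently, if the $2$-torsion of the Shafarevich-Tate group of $E_p/\mathbb{Q}$ is trivial), then $p$ is a reflecting congruent number.
   Context: A positive integer $n$ is a congruent number if it is the area of a right triangle with rational side lengths. A nonzero integer $n$ is called a reflecting congruent number (equivalently, a $(2,2)$-reflecting number) if there exists a positive rational number $t$ such that $n-t^{2}$ and $n+t^{2}$ are both squares of rational numbers. *)

(* Defs.v *)
From HB Require Import structures.
From mathcomp Require Import all_boot all_order all_algebra all_field.
From mathcomp Require Import reals.

Set Implicit Arguments.
Unset Strict Implicit.
Unset Printing Implicit Defensive.

Import Order.TTheory GRing.Theory Num.Theory.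
Local Open Scope ring_scope.

Definition congruent_number (n : nat) : Prop :=
  (0 < n)%N /\
  exists a b c : rat,
    [/\ 0 < a, 0 < b, 0 < c, a ^+ 2 + b ^+ 2 = c ^+ 2 & a * b / 2 = n%:R].

Definition reflecting_congruent_number (n : int) : Prop :=
  n != 0 /\
  exists t : rat,
    [/\ 0 < t, exists u : rat, n%:~R - t ^+ 2 = u ^+ 2
             & exists v : rat, n%:~R + t ^+ 2 = v ^+ 2].

(* Points of a curve y^2 = x^3 + a x + b: None is the point at infinity. *)
Definition point (F : Type) : Type := option (F * F).

Definition map_point (F L : Type) (f : F -> L) (P : point F) : point L :=
  omap (fun xy => (f xy.1, f xy.2)) P.

(* A curve y^2 = x^3 + a x + b with rational coefficients, meant to be used
   when 4 a^3 + 27 b^2 != 0. *)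
Record curve := Curve { coef_a : rat; coef_b : rat }.

Definition E_ (n : nat) : curve := Curve (- n%:R ^+ 2) 0.

Section GroupLaw.
Variables (F : fieldType) (E : curve).
Implicit Types P Q : point F.

Definition on_curve P : Prop :=
  if P is Some (x, y)
  then y ^+ 2 = x ^+ 3 + ratr (coef_a E) * x + ratr (coef_b E) else True.

Definition opp_point P : point F :=
  if P is Some (x, y) then Some (x, - y) else None.

(* The chord-tangent law; in the tangent case both points are on the curve,
   have the same abscissa and are not opposite, hence are equal. *)
Definition add_point P Q : point F :=
  match P, Q with
  | None, _ => Q
  | _, None => P
  | Some (x1, y1), Some (x2, y2) =>
      if (x1 == x2) && (y1 == - y2) then None else
      let l := if x1 == x2 then (3 * x1 ^+ 2 + ratr (coef_a E)) / (2 * y1)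
               else (y2 - y1) / (x2 - x1) in
      let x3 := l ^+ 2 - x1 - x2 in
      Some (x3, l * (x1 - x3) - y1)
  end.

Definition sub_point P Q : point F := add_point P (opp_point Q).

End GroupLaw.

(* E(Q) is isomorphic to Z^r x T for some finite abelian group T; by the
   Mordell-Weil theorem this holds for exactly one r. *)
Definition has_rank (E : curve) (r : nat) : Prop :=
  exists (T : finZmodType) (f : 'rV[int]_r * T -> point rat),
    [/\ injective f,
        forall P, on_curve E P <-> exists u, f u = P
      & forall u v, f (u + v) = add_point E (f u) (f v)].

(* The absolute Galois group of Q: algC is an algebraic closure of Q, and its
   ring endomorphisms are automorphisms (algC_autK). *)
Definition galQ := {rmorphism algC -> algC}.

Definition galQ_comp (s t : galQ) : galQ := GRing.RMorphism.clone _ _ (s \o t) _.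

(* Continuity is for the Krull topology on galQ and the discrete topology on
   the points. *)
Definition continuous_cochain (c : galQ -> point algC) : Prop :=
  forall s : galQ, exists S : seq algC,
    forall t : galQ, {in S, s =1 t} -> c t = c s.

Definition cocycle (E : curve) (c : galQ -> point algC) : Prop :=
  [/\ continuous_cochain c,
      forall s, on_curve E (c s)
    & forall s t, c (galQ_comp s t) = add_point E (c s) (map_point s (c t))].

Definition coboundary (E : curve) (c : galQ -> point algC) : Prop :=
  exists2 P : point algC,
    on_curve E P & forall s : galQ, c s = sub_point E (map_point s P) P.

Definition padic_abs (q : nat) (x : rat) : rat :=
  if x == 0 then 0 else
  q%:R ^ ((logn q `|denq x|%N)%:Z - (logn q `|numq x|%N)%:Z).

(* (K, abs) is the completion of Q for the q-adic absolute value, i.e. Q_q; the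
   values of the absolute value on Q_q are rational. *)
Definition padic_completion (q : nat) (K : fieldType) (abs : K -> rat) : Prop :=
  [/\ [/\ forall x, 0 <= abs x,
          forall x, abs x = 0 <-> x = 0,
          forall x y, abs (x * y) = abs x * abs y
        & forall x y, abs (x + y) <= Num.max (abs x) (abs y)],
      forall r : rat, abs (ratr r) = padic_abs q r,
      forall (x : K) (e : rat), 0 < e -> exists r : rat, abs (x - ratr r) < e
    & forall u : nat -> K,
        (forall e : rat, 0 < e -> exists N, forall m n,
           (N <= m)%N -> (N <= n)%N -> abs (u m - u n) < e) ->
        exists x : K, forall e : rat, 0 < e -> exists N, forall n,
          (N <= n)%N -> abs (u n - x) < e].

(* The restriction of the class of c to H^1(K, E) is trivial. Here L ranges over
   the algebraic closures of K and i over the embeddings of algC in L (the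
   triviality does not depend on these choices), s ranges over Gal(L / K), and t
   is the restriction of s to algC along i. *)
Definition trivial_over (E : curve) (c : galQ -> point algC)
    (K : fieldType) : Prop :=
  forall (L : closedFieldType) (j : {rmorphism K -> L})
         (i : {rmorphism algC -> L}),
    (forall x : L, algebraicOver j x) ->
  exists2 P : point L, on_curve E P &
    forall (s : {rmorphism L -> L}) (t : galQ),
      (forall x, s (j x) = j x) -> (forall z, i (t z) = s (i z)) ->
      map_point i (c t) = sub_point E (map_point s P) P.

Definition everywhere_locally_trivial (E : curve) (c : galQ -> point algC) :
    Prop :=
  (forall R : realType, trivial_over E c R) /\
  (forall (q : nat) (K : fieldType) (abs : K -> rat),
     prime q -> padic_completion q abs -> trivial_over E c K).

(* Sha(E/Q)[2] = 0, where Sha(E/Q) is the kernel of the map from H^1(Q, E) to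
   the product of the H^1(Q_v, E) over all places v of Q. *)
Definition sha2_trivial (E : curve) : Prop :=
  forall c : galQ -> point algC,
    cocycle E c -> everywhere_locally_trivial E c ->
    coboundary E (fun s => add_point E (c s) (c s)) -> coboundary E c.

(* Main.v *)
Require Import Defs.
From HB Require Import structures.
From mathcomp Require Import all_boot all_order all_algebra all_field.
From mathcomp Require Import reals.
From mathcomp Require Import boolp ring lra zify.

Set Implicit Arguments.
Unset Strict Implicit.
Unset Printing Implicit Defensive.

Import Order.TTheory GRing.Theory Num.Theory.
Local Open Scope ring_scope.

(** A rational point of E_p with abscissa x, such that (x, x - p, x + p) is
    (1, p, p) modulo squares, yields t = p / sqrt x with p - t^2 and p + t^2
    squares. So one has to realize the class (1, p, p) of the 2-Selmer group.

    If the rank is 2, then E(Q) / 2 E(Q) has 2^2 * #E(Q)[2] = 16 elements, and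
    it embeds by (x, x + p) in the group of pairs (d1, d3) of square classes
    with d1 in <-1, p> and d3 in <2, p>, which also has 16 elements; so every
    class is realized.

    If Sha[2] = 0, consider the cocycle s |-> O or (0, 0), according to whether
    s fixes sqrt p or not. It is everywhere locally trivial: p is a square in R
    and in Q_2, -1 is a square in Q_q when q = 1 mod 4 (in particular when
    q = p), and when q = 3 mod 4 the equations p - t^2 = u^2 and
    p + t^2 = v^2 can be solved modulo q and then lifted. So the cocycle is
    s |-> s P - P for some point P, and 2 P is a rational point of
    class (1, p, p). *)

(** * Translation by (0, 0) and the cocycle attached to sqrt p *)

Lemma ratr_coef_a (F : fieldType) (p : nat) :
  ratr (coef_a (E_ p)) = - p%:R ^+ 2 :> F.
Proof.
have -> : coef_a (E_ p) = (- p%:Z ^+ 2)%:~R by rewrite /= rmorphN rmorphXn.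
by rewrite ratr_int rmorphN rmorphXn.
Qed.

Lemma on_curveE (F : fieldType) (p : nat) (x y : F) :
  on_curve (E_ p) (Some (x, y)) <-> y ^+ 2 = x ^+ 3 - p%:R ^+ 2 * x.
Proof. by rewrite /on_curve ratr_coef_a (ratr_nat F 0) addr0 mulNr. Qed.

Ltac nonzero :=
  by repeat (apply/andP; split);
  rewrite ?(oppr_eq0, invr_eq0, oner_eq0) ?mulf_neq0 ?expf_neq0 ?oppr_eq0.

Section Translation.
Variables (F : fieldType) (p : nat).
Hypotheses (two_neq0 : (2 : F) != 0) (p_neq0 : (p%:R : F) != 0).

(** The line of slope y / x through (0, 0) meets the curve at two further abscissae, with product -
    p^2; hence the first point displayed is (x, y) + (0, 0). *)
Lemma sub_point_translate (x y : F) : x != 0 -> on_curve (E_ p) (Some (x, y)) ->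
  sub_point (E_ p) (Some (- p%:R ^+ 2 / x, p%:R ^+ 2 * y / x ^+ 2)) (Some (x, y))
  = Some (0, 0).
Proof.
move=> x0 /on_curveE; rewrite /sub_point /= ratr_coef_a; move: (p%:R : F) p_neq0 => P P0 Exy.
(* If the abscissae agree, the translate is the opposite of (x, y), and the tangent formula
   applies. *)
have [Ex|nEx] := eqVneq (- P ^+ 2 / x) x.
  have Ex2 : x ^+ 2 = - P ^+ 2 by rewrite -[in RHS](divfK x0 (- P ^+ 2)) Ex expr2.
  have y0 : y != 0.
    apply/eqP => y0; have : 2 * P ^+ 2 * x = 0.
      transitivity (- y ^+ 2); last by rewrite y0; ring.
      by rewrite Exy (exprS x) Ex2; ring.
    by apply/eqP; rewrite !mulf_neq0 ?expf_neq0.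
  have Ey : P ^+ 2 * y / x ^+ 2 = - y.
    by rewrite Ex2; field; nonzero.
  have nyy : - y != y.
    by rewrite -subr_eq0 (_ : - y - y = - (2 * y)) ?oppr_eq0 ?mulf_neq0 //; ring.
  rewrite Ex Ey opprK (negPf nyy) /=.
  have Ey2 : y ^+ 2 = - 2 * P ^+ 2 * x.
    by rewrite Exy (exprS x) Ex2; ring.
  have ny0 : 2 * - y != 0 by rewrite mulf_neq0 ?oppr_eq0.
  have -> : (3 * x ^+ 2 - P ^+ 2) / (2 * - y) = 2 * P ^+ 2 / y.
    by rewrite Ex2; field; nonzero.
  have E3 : (2 * P ^+ 2 / y) ^+ 2 - x - x = 0.
    rewrite expr_div_n Ey2 exprMn -exprM (_ : P ^+ (2 * 2) = - x ^+ 2 * P ^+ 2);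
      last by rewrite Ex2; ring.
    by field; nonzero.
  rewrite E3 subr0; congr (Some (_, _)).
  by rewrite -[X in _ + X = _](mulfK y0) -expr2 Ey2; field; nonzero.
have xx0 : x ^+ 2 + P ^+ 2 != 0.
  apply: contra nEx; rewrite addr_eq0 => /eqP Ex2.
  by rewrite -Ex2 expr2 mulfK.
have -> : (- y - P ^+ 2 * y / x ^+ 2) / (x - - P ^+ 2 / x) = - y / x.
  by field; rewrite x0 opprK -expr2.
have -> : (- y / x) ^+ 2 - - P ^+ 2 / x - x = 0.
  by rewrite expr_div_n sqrrN Exy; field; nonzero.
by rewrite subr0; congr (Some (_, _)); field; nonzero.
Qed.

(** The line through (x1, y1) and (x, - y) passes through (0, 0), so it has the equation Y = l X,
    and Vieta's formulas give x1 x = - p^2. *)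
Lemma sub_point_eq_translate (x1 y1 x y : F) : x1 != 0 -> x != 0 ->
  on_curve (E_ p) (Some (x1, y1)) -> on_curve (E_ p) (Some (x, y)) ->
  sub_point (E_ p) (Some (x1, y1)) (Some (x, y)) = Some (0, 0) ->
  x1 = - p%:R ^+ 2 / x /\ y1 = p%:R ^+ 2 * y / x ^+ 2.
Proof.
move=> x10 x0 /on_curveE Ex1y1 /on_curveE Exy.
rewrite /sub_point /= ratr_coef_a; move: (p%:R : F) p_neq0 Ex1y1 Exy => P P0 Ex1y1 Exy.
have [Ex|nEx] := eqVneq x1 x.
  move: x10 Ex1y1; rewrite Ex opprK /= => _ Ex1y1.
  have [->//|nyy1] := eqVneq y1 y.
  have Ey1 : y1 = - y.
    have /eqP : (y1 - y) * (y1 + y) = 0.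
      by transitivity (y1 ^+ 2 - y ^+ 2); [ring | rewrite Ex1y1 Exy subrr].
    by rewrite mulf_eq0 subr_eq0 (negPf nyy1) addr_eq0 => /eqP.
  have y0 : y != 0.
    by apply: contra nyy1 => /eqP y0; rewrite Ey1 y0 oppr0.
  set l := (3 * _ - _) / _ => -[El1 El2].
  have {}El1 : l ^+ 2 - x - x = 0 by [].
  rewrite El1 subr0 Ey1 opprK in El2.
  have El : l * (2 * - y) = 3 * x ^+ 2 - P ^+ 2.
    by rewrite /l Ey1 divfK // mulf_neq0 ?oppr_eq0.
  have Ex2 : x ^+ 2 = - P ^+ 2.
    apply: (mulfI x0); apply/eqP; rewrite -subr_eq0; apply/eqP.
    transitivity (x * (3 * x ^+ 2 - P ^+ 2) - 2 * (x ^+ 3 - P ^+ 2 * x)); first by ring.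
    rewrite -El -Exy.
    by transitivity (- 2 * y * (l * x + y)); [ring | rewrite El2 mulr0].
  have -> : P ^+ 2 = - x ^+ 2 by rewrite Ex2 opprK.
  by rewrite Ey1; split; field; nonzero.
set l := (_ - _) / _ => -[El1 El2].
have xx1 : x - x1 != 0 by rewrite subr_eq0 eq_sym.
rewrite El1 subr0 in El2.
have {}El2 : y1 = l * x1 by apply/esym/eqP; rewrite -subr_eq0 El2.
have Ely : l * x = - y.
  by have := divfK xx1 (- y - y1); rewrite -/l mulrBr -El2 => /addIr.
have El3 : l ^+ 2 = x1 + x by apply/eqP; rewrite -subr_eq0 opprD addrA El1.
have Ex1x : x1 * x = - P ^+ 2.
  apply: (mulfI x10); apply/eqP; rewrite -subr_eq0; apply/eqP.
  transitivity ((x1 + x) * x1 ^+ 2 - (x1 ^+ 3 - P ^+ 2 * x1)); first by ring.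
  by rewrite -El3 -Ex1y1 El2; ring.
have -> : P ^+ 2 = - (x1 * x) by rewrite Ex1x opprK.
split; first by field.
have -> : y = - (l * x) by rewrite Ely opprK.
by rewrite El2; field.
Qed.

End Translation.

Lemma sub_point_eqNone (F : fieldType) (E : curve) (P Q : point F) :
  sub_point E P Q = None -> P = Q.
Proof.
case: P Q => [[x1 y1]|] [[x2 y2]|] //=; rewrite /sub_point /=.
by case: ifP => // /andP[/eqP-> /eqP->] _; rewrite opprK.
Qed.

(** The conjugates of [x] generate a Galois number field, each of whose automorphisms extends to
    [algC]; so [x] comes from the fixed field, which is the field of rationals. *)
Lemma galQ_fixed (x : algC) : (forall s : galQ, s x = x) -> exists a : rat, x = ratr a.
Proof.
move=> fix_x; have [q [Dq mon_q] _] := minCpolyP x.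
have [r Dr] := closed_field_poly_normal (minCpoly x).
rewrite (monicP (minCpoly_monic x)) scale1r in Dr.
have [Qs [QsC [r1 Dr1 genQs]]] := num_field_exists r.
have inalgE (f : {rmorphism Qs -> algC}) : f \o in_alg Qs =1 ratr.
  by move=> a; rewrite -(fmorph_eq_rat (f \o in_alg Qs)).
have split_q : map_poly (in_alg Qs) q = \prod_(y <- r1) ('X - y%:P).
  apply: (map_poly_inj QsC); rewrite -map_poly_comp (eq_map_poly (inalgE QsC)) -Dq Dr -Dr1.
  rewrite rmorph_prod big_map; apply: eq_bigr => y _.
  by rewrite rmorphB /= map_polyX map_polyC.
have Qs_ax : FieldExt_isSplittingField _ Qs.
  constructor; exists (map_poly (in_alg Qs) q); first by apply/polyOver1P; exists q.
  by exists r1; first by rewrite split_q eqpxx.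
pose L : splittingFieldType rat := HB.pack_for (splittingFieldType rat) Qs Qs_ax.
have galL : galois 1 {:L}.
  apply/and3P; split; [exact: sub1v | | exact: normalFieldf].
  by apply/separableP => y _; apply: pcharf0_separable => l;
    rewrite -(pchar_num rat) -(fmorph_pchar (in_alg Qs)).
have : x \in r by rewrite -root_prod_XsubC -Dr root_minCpoly.
rewrite -Dr1 => /mapP[y _ Dx].
suff : (y : L) \in fixedField 'Gal({:L} / 1)%g.
  rewrite (galois_fixedField galL) => /vlineP[a Dy]; exists a.
  by rewrite Dx Dy -(inalgE QsC).
apply/fixedFieldP => [|g _]; first exact: memvf.
have [nu Dnu] := extend_algC_subfield_aut QsC (g : {rmorphism L -> L}).
by apply: (fmorph_inj QsC); rewrite Dnu -Dx fix_x.
Qed.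

(** With t = p / r one has p - t^2 = p (r^2 - p) / r^2 = (p a / r)^2, and similarly for p + t^2. *)
Lemma reflecting_of_squares (p : nat) (r a b : rat) : (0 < p)%N ->
  r ^+ 2 - p%:R = p%:R * a ^+ 2 -> r ^+ 2 + p%:R = p%:R * b ^+ 2 ->
  reflecting_congruent_number p%:Z.
Proof.
move=> p_gt0 Ea Eb; have p0 : (p%:R : rat) != 0 by rewrite pnatr_eq0 -lt0n.
have r0 : r != 0.
  apply/eqP => r0; move: Ea; rewrite r0 expr0n sub0r -mulrN1 => /(mulfI p0) Ea.
  by have := sqr_ge0 a; rewrite -Ea.
split; first by rewrite eqz_nat -lt0n.
exists `|p%:R / r|; split; first by rewrite normr_gt0 mulf_neq0 ?invr_eq0.
- exists (p%:R * a / r); rewrite real_normK ?num_real // pmulrn.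
  rewrite (_ : (p%:R * a / r) ^+ 2 = p%:R * (p%:R * a ^+ 2) / r ^+ 2); last by field.
  by rewrite -Ea; field.
- exists (p%:R * b / r); rewrite real_normK ?num_real // pmulrn.
  rewrite (_ : (p%:R * b / r) ^+ 2 = p%:R * (p%:R * b ^+ 2) / r ^+ 2); last by field.
  by rewrite -Eb; field.
Qed.

Section SqrtCocycle.
Variable p : nat.
Hypothesis p_gt0 : (0 < p)%N.
Let w : algC := sqrtC p%:R.

Definition sqrt_cocycle (s : galQ) : point algC :=
  if s w == w then None else Some (0, 0).

Let w2 : w ^+ 2 = p%:R. Proof. exact: sqrtCK. Qed.

Let w_neq0 : w != 0. Proof. by rewrite sqrtC_eq0 pnatr_eq0 -lt0n. Qed.

Let galQ_w (s : galQ) : s w = w \/ s w = - w.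
Proof.
have /eqP : s w ^+ 2 = w ^+ 2 by rewrite -rmorphXn w2 rmorph_nat.
by rewrite eqf_sqr => /orP[] /eqP; [left | right].
Qed.

Let Nw : - w == w = false.
Proof. by apply/negbTE; rewrite eqNr. Qed.

(** The values are rational and form a group of order 2, so the cocycle condition says that s |-> s
    w / w is a character; it depends only on s w, whence continuity. *)
Lemma sqrt_cocycleP : cocycle (E_ p) sqrt_cocycle.
Proof.
split=> [s | s | s t].
- by exists [:: w] => t /(_ w (mem_head _ _)) st; rewrite /sqrt_cocycle st.
- rewrite /sqrt_cocycle; case: eqP => // _; apply/on_curveE.
  by rewrite !expr0n mulr0 subr0.
rewrite /sqrt_cocycle /galQ_comp /=.
have [-> | ->] := galQ_w t; rewrite ?eqxx ?Nw /=; first by case: ifP.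
rewrite rmorphN rmorph0; have [-> | ->] := galQ_w s; rewrite ?opprK ?eqxx ?Nw //=.
by rewrite oppr0 eqxx.
Qed.

Lemma sqrt_cocycle_double :
  coboundary (E_ p) (fun s => add_point (E_ p) (sqrt_cocycle s) (sqrt_cocycle s)).
Proof.
exists None => // s; rewrite /sqrt_cocycle; case: ifP => //= _.
by rewrite oppr0 eqxx.
Qed.

Lemma trivial_over_sqrt (K : fieldType) (k : K) :
  k ^+ 2 = p%:R -> trivial_over (E_ p) sqrt_cocycle K.
Proof.
move=> k2 L j i _; exists None => // s t s_id it.
suff tw : t w = w by rewrite /sqrt_cocycle tw eqxx.
apply: (fmorph_inj i); rewrite it.
have /eqP : i w ^+ 2 = j k ^+ 2 by rewrite -!rmorphXn w2 k2 !rmorph_nat.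
by rewrite eqf_sqr => /orP[] /eqP ->; rewrite ?rmorphN s_id.
Qed.

(** A point trivializes the cocycle if the automorphisms fixing sqrt p fix it and those negating
    sqrt p translate it by (0, 0). *)
Lemma sqrt_cocycle_twist (L : fieldType) (i : {rmorphism algC -> L})
    (x y : L) (s : {rmorphism L -> L}) (t : galQ) :
  x != 0 -> on_curve (E_ p) (Some (x, y)) -> (forall z, i (t z) = s (i z)) ->
  (s (i w) = i w -> s x = x /\ s y = y) ->
  (s (i w) = - i w -> s x = - p%:R ^+ 2 / x /\ s y = p%:R ^+ 2 * y / x ^+ 2) ->
  map_point i (sqrt_cocycle t) =
  sub_point (E_ p) (map_point s (Some (x, y))) (Some (x, y)).
Proof.
move=> x0 Exy it fix_xy move_xy.
have natL n : (n.+1%:R : L) != 0 by rewrite -(rmorph_nat i) fmorph_eq0 pnatr_eq0.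
have pL : (p%:R : L) != 0 by rewrite -(prednK p_gt0).
rewrite /sqrt_cocycle; have [tw | tw] := galQ_w t; rewrite tw ?eqxx ?Nw.
  have [|/= -> ->] := fix_xy; first by rewrite -it tw.
  by rewrite /sub_point /= opprK !eqxx.
have [|sx sy] := move_xy; first by rewrite -it tw rmorphN.
by rewrite [map_point s _]/= sx sy sub_point_translate //= rmorph0.
Qed.

(* The point below is a half of (0, 0). *)
Lemma trivial_over_sqrtN1 (K : fieldType) (k : K) :
  k ^+ 2 = -1 -> trivial_over (E_ p) sqrt_cocycle K.
Proof.
move=> k2 L j i _; set r := i w; set e := j k.
have e2 : e ^+ 2 = -1 by rewrite -rmorphXn k2 rmorphN1.
have r2 : r ^+ 2 = p%:R by rewrite -rmorphXn w2 rmorph_nat.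
have r0 : r != 0 by rewrite fmorph_eq0.
have e0 : e != 0 by rewrite -sqrf_eq0 e2 oppr_eq0 oner_eq0.
have Exy : on_curve (E_ p) (Some (e * r ^+ 2, (1 - e) * r ^+ 3)).
  apply/on_curveE; rewrite -r2; apply/eqP; rewrite -subr_eq0; apply/eqP.
  transitivity (r ^+ 6 * (1 + e ^+ 2) * (1 - e)); first by ring.
  by rewrite e2 subrr mulr0 mul0r.
exists (Some (e * r ^+ 2, (1 - e) * r ^+ 3)) => // s t s_id it.
have se : s e = e by apply: s_id.
apply: sqrt_cocycle_twist => //; first by rewrite mulf_neq0 ?expf_neq0.
  by move=> sr; rewrite !(rmorphM, rmorphB, rmorphXn, rmorph1) /= sr se.
(* As e^2 = -1, translation by (0, 0) fixes the abscissa e r^2 and negates the ordinate, just as r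
   |-> - r does. *)
move=> sr; rewrite !(rmorphM, rmorphB, rmorphXn, rmorph1) /= sr se -r2.
split; last by rewrite (exprMn _ e) e2; field; nonzero.
have -> : - (r ^+ 2) ^+ 2 = e ^+ 2 * r ^+ 4 by rewrite e2; ring.
by field; nonzero.
Qed.

(* The point below is a half of the point with abscissa (p / t)^2. *)
Lemma trivial_over_squares (K : fieldType) (t u v : K) : t != 0 ->
  p%:R - t ^+ 2 = u ^+ 2 -> p%:R + t ^+ 2 = v ^+ 2 ->
  trivial_over (E_ p) sqrt_cocycle K.
Proof.
move=> t0 Eu Ev L j i _; set r := i w.
have r2 : r ^+ 2 = p%:R by rewrite -rmorphXn w2 rmorph_nat.
have r0 : r != 0 by rewrite fmorph_eq0.
have T0 : j t != 0 by rewrite fmorph_eq0.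
have {}Eu : r ^+ 2 - j t ^+ 2 = j u ^+ 2 by rewrite r2 -!rmorphXn -Eu rmorphB rmorph_nat.
have {}Ev : r ^+ 2 + j t ^+ 2 = j v ^+ 2 by rewrite r2 -!rmorphXn -Ev rmorphD rmorph_nat.
(* Square roots of X, X - p and X + p for X = (p / t)^2. Negating r fixes [r1] and negates [r2'] and
   [r3], which takes [x] to [x']. *)
pose r1 := r ^+ 2 / j t; pose r2' := r * j u / j t; pose r3 := r * j v / j t.
have E12 : r1 ^+ 2 - r2' ^+ 2 = r ^+ 2.
  by rewrite /r1 /r2' !expr_div_n (exprMn _ _ (j u)) -Eu; field.
have E13 : r1 ^+ 2 - r3 ^+ 2 = - r ^+ 2.
  by rewrite /r1 /r3 !expr_div_n (exprMn _ _ (j v)) -Ev; field.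
pose x := (r1 + r2') * (r1 + r3); pose y := x * (r2' + r3).
pose x' := (r1 - r2') * (r1 - r3).
have xx' : x * x' = - r ^+ 4.
  transitivity ((r1 ^+ 2 - r2' ^+ 2) * (r1 ^+ 2 - r3 ^+ 2)); first by rewrite /x /x'; ring.
  by rewrite E12 E13; ring.
have x0 : x != 0.
  have : x * x' != 0 by rewrite xx' oppr_eq0 expf_neq0.
  by rewrite mulf_eq0 => /norP[].
have Exy : on_curve (E_ p) (Some (x, y)).
  apply/on_curveE; rewrite -r2.
  have E1 : x - r ^+ 2 = (r1 + r2') * (r2' + r3) by rewrite -E12 /x; ring.
  have E2 : x + r ^+ 2 = (r1 + r3) * (r2' + r3) by rewrite -[r ^+ 2]opprK -E13 /x; ring.
  transitivity (x * ((x - r ^+ 2) * (x + r ^+ 2))); last by ring.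
  by rewrite E1 E2 /y /x; ring.
exists (Some (x, y)) => // s g s_id ig.
apply: sqrt_cocycle_twist => // sr.
  by rewrite /y /x /r1 /r2' /r3 !(rmorphM, rmorphD, fmorphV, rmorphXn) /= !s_id sr.
have Ex' : x' = - r ^+ 4 / x by rewrite -xx' mulrC mulKf.
have sr1 : s r1 = r1 by rewrite /r1 !(rmorphM, fmorphV, rmorphXn) /= s_id sr sqrrN.
have sr2 : s r2' = - r2' by rewrite /r2' !(rmorphM, fmorphV) /= !s_id sr !mulNr.
have sr3 : s r3 = - r3 by rewrite /r3 !(rmorphM, fmorphV) /= !s_id sr !mulNr.
have sx : s x = x' by rewrite /x rmorphM !rmorphD /= sr1 sr2 sr3.
rewrite -r2 -exprM; split; first by rewrite sx Ex'.
by rewrite /y rmorphM rmorphD /= sx sr2 sr3 Ex'; field.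
Qed.

End SqrtCocycle.

(** * Square classes of rationals *)

(** The parity of the q-adic valuation: the product of numerator and denominator has the square
    class of their quotient. *)
Definition odd_val (q : nat) (a : rat) : bool :=
  odd (logn q (`|numq a| * `|denq a|)).

Lemma odd_logn_square q m n : (0 < m)%N -> (0 < n)%N ->
  odd (logn q (m * n ^ 2)) = odd (logn q m).
Proof.
by move=> m0 n0; rewrite lognM ?expn_gt0 ?n0 // lognX oddD oddM addbF.
Qed.

Lemma odd_valE q (a : rat) (m n : int) : n != 0 -> a != 0 ->
  a * n%:~R ^+ 2 = m%:~R -> odd_val q a = odd (logn q `|m|).
Proof.
move=> n0 a0 Em; have d0 := denq_neq0 a.
have Ez : numq a * denq a * n ^+ 2 = m * denq a ^+ 2.
  apply: (@intr_inj rat); by rewrite !expr2 !intrM -Em numqE; ring.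
have Enat : (`|numq a| * `|denq a| * `|n| ^ 2 = `|m| * `|denq a| ^ 2)%N.
  by rewrite -!abszX -!abszM Ez.
have m0 : m != 0.
  by rewrite -(intr_eq0 rat) -Em mulf_neq0 ?expf_neq0 ?intr_eq0.
rewrite /odd_val -(@odd_logn_square q (_ * _) `|n|%N) ?absz_gt0 //
  ?muln_gt0 ?absz_gt0 ?numq_eq0 ?a0 //.
by rewrite Enat odd_logn_square ?absz_gt0.
Qed.

Lemma odd_valM q (a b : rat) : a != 0 -> b != 0 ->
  odd_val q (a * b) = odd_val q a (+) odd_val q b.
Proof.
move=> a0 b0.
rewrite (@odd_valE q _ (numq a * denq a * (numq b * denq b)) (denq a * denq b))
  ?mulf_neq0 ?denq_neq0 //.
  by rewrite abszM lognM ?absz_gt0 ?mulf_neq0 ?denq_neq0 ?numq_eq0 // oddD /odd_val !abszM.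
by rewrite !rmorphM /= !numqE; ring.
Qed.

Lemma odd_val_sqr q (a : rat) : odd_val q (a ^+ 2) = false.
Proof.
have [->|a0] := eqVneq a 0; first by rewrite expr0n /odd_val (numq_int 0) mul0n logn0.
by rewrite expr2 odd_valM // addbb.
Qed.

Lemma odd_valN q (a : rat) : odd_val q (- a) = odd_val q a.
Proof. by rewrite /odd_val numqN denqN abszN. Qed.

Lemma odd_val_nat q n : odd_val q n%:R = odd (logn q n).
Proof. by rewrite /odd_val pmulrn numq_int denq_int absz1 muln1 absz_nat. Qed.

Lemma even_logn_square (n : nat) : (0 < n)%N ->
  (forall q, prime q -> ~~ odd (logn q n)) -> exists m, n = (m ^ 2)%N.
Proof.
move=> n0 even_n; exists (\prod_(q <- primes n) q ^ (logn q n)./2)%N.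
rewrite {1}(prod_prime_decomp n0) prime_decompE big_map /= -mulnn -big_split /=.
rewrite !big_seq; apply: eq_bigr => q; rewrite mem_primes => /and3P[q_pr _ _].
by rewrite -expnD addnn even_halfK // even_n.
Qed.

(** Numerator times denominator is a perfect square, and [a] is that product divided by the square
    of the denominator. *)
Lemma rat_squareP (a : rat) : 0 < a ->
  (forall q, prime q -> odd_val q a = false) -> exists b, a = b ^+ 2.
Proof.
move=> a_gt0 even_a; have d0 := denq_neq0 a.
have na0 : numq a != 0 by rewrite numq_eq0 gt_eqF.
have [|q q_pr|m Em] := @even_logn_square (`|numq a| * `|denq a|)%N.
- by rewrite muln_gt0 !absz_gt0 na0.
- by rewrite -/(odd_val q a) even_a.
have d0' : (denq a)%:~R != 0 :> rat by rewrite intr_eq0.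
exists (m%:R / (denq a)%:~R); rewrite expr_div_n -natrX -Em natrM.
rewrite !pmulrn gtz0_abs ?numq_gt0 // absz_denq numqE.
by field.
Qed.

Lemma rat_sqr_neq_prime (p : nat) (a : rat) : prime p -> a ^+ 2 != p%:R.
Proof.
move=> p_pr; apply/eqP => Ea; have := odd_val_sqr p a.
by rewrite Ea odd_val_nat -[in logn _ _](expn1 p) pfactorK.
Qed.

(** * From a trivialization of the cocycle to a reflecting number *)

Lemma galQ_sqrt_moved (p : nat) : prime p ->
  exists s : galQ, s (sqrtC p%:R) <> sqrtC p%:R.
Proof.
move=> p_pr; apply/existsNP => /galQ_fixed[a Ea].
have /eqP := rat_sqr_neq_prime a p_pr; apply.
by apply: (fmorph_inj (ratr : rat -> algC)); rewrite rmorphXn /= -Ea sqrtCK ratr_nat.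
Qed.

(** Translating P by (0, 0) fixes (x^2 + p^2) / (2 y) and negates (x^2 - 2 p x - p^2) / (2 y) and
    (x^2 + 2 p x - p^2) / (2 y). So the first, and the other two divided by sqrt p, are
    Galois-invariant, hence rational. *)
Lemma reflecting_of_coboundary (p : nat) : prime p ->
  coboundary (E_ p) (sqrt_cocycle p) -> reflecting_congruent_number p%:Z.
Proof.
move=> p_pr [P onP cP]; have p_gt0 := prime_gt0 p_pr.
have [s0 s0w] := galQ_sqrt_moved p_pr.
move: s0w cP; rewrite /sqrt_cocycle; set w := sqrtC _ => s0w cP.
have w2 : w ^+ 2 = p%:R by apply: sqrtCK.
have p0 : (p%:R : algC) != 0 by rewrite pnatr_eq0 -lt0n.
have w0 : w != 0 by rewrite -sqrf_eq0 w2.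
have two0 : (2 : algC) != 0 by rewrite pnatr_eq0.
(* P is neither O nor a 2-torsion point: those are rational, so [s0] would give O instead of (0, 0).
   This yields x != 0 and y != 0 below. *)
case: P onP cP => [[x y]|] onP cP; last first.
  by have := cP s0; case: eqP.
have fixP (s : galQ) : s w = w -> s x = x /\ s y = y.
  move=> sw; have := cP s; rewrite sw eqxx => /esym/sub_point_eqNone.
  by case=> -> ->.
have /on_curveE Exy := onP.
have moveP (s : galQ) : s w <> w ->
    sub_point (E_ p) (Some (s x, s y)) (Some (x, y)) = Some (0, 0).
  by move=> /eqP/negbTE sw; rewrite -[LHS](cP s) sw.
have x0 : x != 0.
  apply/eqP => x0; have y0 : y = 0.
    by apply/eqP; rewrite -sqrf_eq0 Exy x0 expr0n mulr0 subr0.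
  by have := moveP _ s0w; rewrite x0 y0 !rmorph0 /sub_point /= !oppr0 !eqxx.
have {}moveP (s : galQ) : s w <> w ->
    s x = - p%:R ^+ 2 / x /\ s y = p%:R ^+ 2 * y / x ^+ 2.
  move=> /moveP; apply: sub_point_eq_translate => //; first by rewrite fmorph_eq0.
  by apply/on_curveE; move: (congr1 s Exy); rewrite rmorphB !rmorphXn rmorphM rmorphXn rmorph_nat.
have y0 : y != 0.
  apply/eqP => y0; have [sx _] := moveP _ s0w.
  have Ex : x = p%:R \/ x = - p%:R.
    have /eqP : x * ((x - p%:R) * (x + p%:R)) = 0.
      by transitivity (y ^+ 2); [rewrite Exy; ring | rewrite y0 expr0n].
    rewrite !mulf_eq0 (negPf x0) subr_eq0 addr_eq0 /=.
    by move=> /orP[] /eqP; [left | right].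
  have x2 : x ^+ 2 = p%:R ^+ 2 by case: Ex => ->; rewrite ?sqrrN.
  have s0x : s0 x = x by case: Ex => ->; rewrite ?rmorphN rmorph_nat.
  have x2' : x ^+ 2 = - p%:R ^+ 2 by rewrite expr2 -{1}s0x sx divfK.
  have : 2 * p%:R ^+ 2 = 0 :> algC by rewrite mulr_natl mulr2n -{1}x2 x2' addNr.
  by apply/eqP; rewrite mulf_neq0 ?expf_neq0.
have sw_neg (s : galQ) : s w <> w -> s w = - w.
  move=> sw; have /eqP : s w ^+ 2 = w ^+ 2 by rewrite -rmorphXn w2 rmorph_nat.
  by rewrite eqf_sqr => /orP[] /eqP.
(* These are square roots of X, (X - p) / p and (X + p) / p, where X is the abscissa
   of 2 P. *)
have [r Er] : exists r, (x ^+ 2 + p%:R ^+ 2) / (2 * y) = ratr r :> algC.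
  apply: galQ_fixed => s; rewrite !(rmorphM, fmorphV, rmorphD, rmorphXn) /= !rmorph_nat.
  have [/eqP sw|/eqP sw] := boolP (s w == w);
    first by have [-> ->] := fixP _ sw; field; nonzero.
  by have [-> ->] := moveP _ sw; field; nonzero.
have [a Ea] : exists a, (x ^+ 2 - 2 * p%:R * x - p%:R ^+ 2) / (2 * y * w) = ratr a :> algC.
  apply: galQ_fixed => s; rewrite !(rmorphM, fmorphV, rmorphB, rmorphXn) /= !rmorph_nat.
  have [/eqP sw|/eqP sw] := boolP (s w == w);
    first by rewrite sw; have [-> ->] := fixP _ sw; field; nonzero.
  by rewrite (sw_neg _ sw); have [-> ->] := moveP _ sw; field; nonzero.
have [b Eb] : exists b, (x ^+ 2 + 2 * p%:R * x - p%:R ^+ 2) / (2 * y * w) = ratr b :> algC.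
  apply: galQ_fixed => s; rewrite !(rmorphM, fmorphV, rmorphD, rmorphB, rmorphXn) /= !rmorph_nat.
  have [/eqP sw|/eqP sw] := boolP (s w == w);
    first by rewrite sw; have [-> ->] := fixP _ sw; field; nonzero.
  by rewrite (sw_neg _ sw); have [-> ->] := moveP _ sw; field; nonzero.
have E4 : 4 * p%:R * y ^+ 2 = 4 * p%:R * (x ^+ 3 - p%:R ^+ 2 * x) by rewrite Exy.
apply: (@reflecting_of_squares p r a b) => //; apply: (fmorph_inj (ratr : rat -> algC));
  rewrite ?rmorphB ?rmorphD rmorphXn [RHS]rmorphM [X in _ = _ * X]rmorphXn /=
    !ratr_nat -Er -?Ea -?Eb.
- transitivity (((x ^+ 2 + p%:R ^+ 2) ^+ 2 - 4 * p%:R * y ^+ 2) / (2 * y) ^+ 2);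
    first by field; nonzero.
  rewrite E4 expr_div_n (exprMn _ _ w) w2; field; nonzero.
- transitivity (((x ^+ 2 + p%:R ^+ 2) ^+ 2 + 4 * p%:R * y ^+ 2) / (2 * y) ^+ 2);
    first by field; nonzero.
  rewrite E4 expr_div_n (exprMn _ _ w) w2; field; nonzero.
Qed.

(** * Local triviality *)

Lemma expr_lt_eps (d e : rat) : 0 <= d -> d < 1 -> 0 < e -> exists n, d ^+ n < e.
Proof.
move=> d0 d1 e0; have c0 : 0 < 1 - d by rewrite subr_gt0.
(* A form of Bernoulli's inequality; in the induction step the two second factors differ by n.+1 (1
   - d)^2. *)
have bern n : d ^+ n * (1 + n%:R * (1 - d)) <= 1.
  elim: n => [|n IHn]; first by rewrite mul0r addr0 mulr1.
  apply: le_trans IHn; rewrite exprSr -mulrA ler_wpM2l ?exprn_ge0 //.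
  rewrite -subr_ge0.
  rewrite (_ : _ - _ = n.+1%:R * (1 - d) ^+ 2); last by rewrite -natr1; ring.
  by rewrite mulr_ge0 ?ler0n ?sqr_ge0.
pose n := Num.bound ((e * (1 - d))^-1); exists n.
have ec0 : 0 < e * (1 - d) by rewrite mulr_gt0.
have en : 1 < e * (1 - d) * n%:R.
  by rewrite -ltr_pdivrMl // mulr1 archi_boundP // invr_ge0 ltW.
rewrite ltNge; apply/negP => e_le; have := bern n; apply/negP; rewrite -ltNge.
have nc0 : 0 <= n%:R * (1 - d) by rewrite mulr_ge0 ?ler0n ?ltW.
apply: lt_le_trans (ler_wpM2r (_ : 0 <= 1 + n%:R * (1 - d)) e_le); last by rewrite addr_ge0.
by rewrite mulrDr mulr1 (mulrC n%:R) mulrA ltr_wpDl // ltW.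
Qed.

(** * Square roots in the completions of the rationals *)

Section PadicSqrt.
Variables (q : nat) (K : fieldType) (abs : K -> rat).
Hypotheses (q_pr : prime q) (K_q : padic_completion q abs).

Let abs_ge0 x : 0 <= abs x. Proof. by case: K_q => -[]. Qed.
Let abs_eq0 x : abs x = 0 <-> x = 0. Proof. by case: K_q => -[]. Qed.
Let absM x y : abs (x * y) = abs x * abs y. Proof. by case: K_q => -[]. Qed.
Let absD x y : abs (x + y) <= Num.max (abs x) (abs y). Proof. by case: K_q => -[]. Qed.
Let abs_rat r : abs (ratr r) = padic_abs q r. Proof. by case: K_q. Qed.

Let abs_neq0 x : x != 0 -> abs x != 0.
Proof. by apply: contraNneq => /abs_eq0->. Qed.

Let abs1 : abs 1 = 1.
Proof.
by apply: (mulfI (abs_neq0 (oner_neq0 K))); rewrite -absM !mulr1.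
Qed.

Let absN x : abs (- x) = abs x.
Proof.
have absN1 : abs (-1) = 1.
  apply/eqP; rewrite -(@eqrXn2 _ 2) ?abs_ge0 ?ler01 //.
  by rewrite expr2 -absM mulrNN mulr1 abs1 expr1n.
by rewrite -mulN1r absM absN1 mul1r.
Qed.

Let absX x n : abs (x ^+ n) = abs x ^+ n.
Proof. by elim: n => [|n IHn]; rewrite ?expr0 // !exprS absM IHn. Qed.

Let absV x : x != 0 -> abs x^-1 = (abs x)^-1.
Proof.
move=> x0; apply: (mulfI (abs_neq0 x0)).
by rewrite -absM !divff ?abs_neq0.
Qed.

Let absD_lt x y e : abs x < e -> abs y < e -> abs (x + y) < e.
Proof. by move=> xe ye; apply: le_lt_trans (absD x y) _; rewrite gt_max xe. Qed.

Let absD_le x y e : abs x <= e -> abs y <= e -> abs (x + y) <= e.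
Proof. by move=> xe ye; apply: le_trans (absD x y) _; rewrite ge_max xe. Qed.

(** Newton's iteration for X^2 - a: the new error is the square of the correction, so a start closer
    than |2|^2 converges, also when |2| < 1. *)
Lemma newton_sqrt (x0 a : K) :
  abs x0 = 1 -> abs 2 <= 1 -> abs (x0 ^+ 2 - a) < abs 2 ^+ 2 ->
  exists x, x ^+ 2 = a.
Proof.
move=> x0_1 abs2_le1 x0a.
have abs2_neq0 : abs 2 != 0.
  apply/eqP => abs20; have := abs_ge0 (x0 ^+ 2 - a).
  by rewrite leNgt (lt_le_trans x0a) // abs20 expr0n.
have abs2_gt0 : 0 < abs 2 by rewrite lt_def abs2_neq0 abs_ge0.
have two0 : (2 : K) != 0 by apply: contraNneq abs2_neq0 => /abs_eq0 ->.
set c := abs 2 in x0a abs2_le1 abs2_neq0 abs2_gt0.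
pose d := abs (x0 ^+ 2 - a) / c ^+ 2.
have d_ge0 : 0 <= d by rewrite divr_ge0 ?exprn_ge0 ?abs_ge0 ?ltW.
have d_lt1 : d < 1 by rewrite ltr_pdivrMr ?exprn_gt0 // mul1r.
have dX_le1 n : d ^+ n <= 1 by rewrite exprn_ile1 // ltW.
pose next x := x - (x ^+ 2 - a) / (2 * x).
pose u n := iter n next x0.
(* With error at most c^2 d^(n+1), the correction is at most c d^(n+1), and its square is at most
   c^2 d^(n+2). *)
have stepP x n : abs x = 1 -> abs (x ^+ 2 - a) <= c ^+ 2 * d ^+ n.+1 ->
    [/\ abs (next x - x) <= d ^+ n.+1, abs (next x) = 1
      & abs (next x ^+ 2 - a) <= c ^+ 2 * d ^+ n.+2].
  move=> x1 xa; have x_neq0 : x != 0 by apply/eqP => /abs_eq0; rewrite x1 => /eqP; rewrite oner_eq0.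
  have xx2 : abs (2 * x) = c by rewrite absM x1 mulr1.
  have E1 : next x - x = - ((x ^+ 2 - a) / (2 * x)) by rewrite /next; ring.
  have E2 : next x ^+ 2 - a = ((x ^+ 2 - a) / (2 * x)) ^+ 2.
    by rewrite /next; field; nonzero.
  have dn_ge0 m : 0 <= d ^+ m by rewrite exprn_ge0.
  have ab : abs ((x ^+ 2 - a) / (2 * x)) <= c * d ^+ n.+1.
    by rewrite absM absV ?mulf_neq0 // xx2 ler_pdivrMr // mulrAC -expr2.
  have ab1 : abs (next x - x) <= d ^+ n.+1.
    by rewrite E1 absN; apply: le_trans ab _; rewrite ler_piMl.
  have ab2 : abs (next x - x) < 1.
    by apply: le_lt_trans ab1 _; rewrite exprn_ilt1.
  split=> //.
    apply/le_anti/andP; split.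
      by rewrite -[next x](subrK x) absD_le ?x1 // ltW.
    rewrite leNgt; apply/negP => nx1; have : abs x < 1.
      rewrite (_ : x = next x + - (next x - x)); last by ring.
      by apply: absD_lt; rewrite ?absN.
    by rewrite x1 ltxx.
  rewrite E2 absX; apply: (@le_trans _ _ ((c * d ^+ n.+1) ^+ 2)).
    by apply: lerXn2r => //; rewrite nnegrE ?mulr_ge0 ?abs_ge0.
  rewrite (exprMn 2 c) ler_wpM2l ?exprn_ge0 ?abs_ge0 // -exprM.
  by apply: ler_wiXn2l; rewrite ?(ltW d_lt1) //; lia.
have uP n : abs (u n) = 1 /\ abs (u n ^+ 2 - a) <= c ^+ 2 * d ^+ n.+1.
  elim: n => [|n [un1 una]].
    by split=> //; rewrite expr1 mulrC divfK ?expf_neq0.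
  by have [_ ? ?] := stepP _ _ un1 una.
have du n m : abs (u (n + m)%N - u n) <= d ^+ n.
  elim: m => [|m IHm]; first by rewrite addn0 subrr (abs_eq0 0).2 // exprn_ge0.
  rewrite addnS -[u _.+1](subrK (u (n + m)%N)) -addrA; apply: absD_le => //.
  have [un1 una] := uP (n + m)%N; have [+ _ _] := stepP _ _ un1 una.
  by move=> h; apply: le_trans h _; apply: ler_wiXn2l; rewrite ?(ltW d_lt1) //; lia.
have [x ux] : exists x, forall e, 0 < e -> exists N, forall n, (N <= n)%N -> abs (u n - x) < e.
  case: K_q => _ _ _; apply => e /(expr_lt_eps d_ge0 d_lt1)[N dN]; exists N => m n.
  move=> /subnKC <- /subnKC <-; apply: le_lt_trans dN.
  rewrite -(subrK (u N) (u (N + (m - N))%N)) -addrA; apply: absD_le => //.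
  by rewrite -opprB absN.
(* If the limit [x] were not a root, the error e = |x^2 - a| would be positive; comparing with [u n]
   for large n gives e < e. *)
exists x; apply/eqP; rewrite -subr_eq0; apply/eqP/abs_eq0/eqP; rewrite eq_le abs_ge0 andbT leNgt.
apply/negP => xa; set e := abs _ in xa.
have [N1 N1P] := ux 1 ltr01; have [N2 N2P] := ux e xa.
have [N3 N3P] := expr_lt_eps d_ge0 d_lt1 xa.
pose n := (N1 + N2 + N3)%N.
have {}N1P : abs (u n - x) < 1 by apply: N1P; rewrite /n -addnA leq_addr.
have {}N2P : abs (u n - x) < e by apply: N2P; rewrite /n addnAC leq_addl.
have [un1 una] := uP n.
have : e < e; last by rewrite ltxx.
rewrite {1}/e (_ : x ^+ 2 - a = (u n ^+ 2 - a) + (u n - x) * ((u n - x) + - (2 * u n)));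
  last by ring.
apply: absD_lt.
  apply: le_lt_trans una _; apply: le_lt_trans N3P.
  apply: le_trans (_ : d ^+ n.+1 <= _); first by rewrite ler_piMl ?exprn_ge0 // exprn_ile1 ?abs_ge0.
  by apply: ler_wiXn2l; rewrite ?(ltW d_lt1) //; lia.
rewrite absM; apply: le_lt_trans N2P; rewrite ler_piMr ?abs_ge0 //.
by apply: absD_le; [exact: ltW | rewrite absN absM un1 mulr1].
Qed.

Lemma padic_abs_int (z : int) n : (q ^ n %| `|z|)%N -> abs z%:~R <= (q%:R ^+ n)^-1.
Proof.
have q1 : 1 < q%:R :> rat by rewrite ltr1n prime_gt1.
rewrite -ratr_int abs_rat /padic_abs intr_eq0 numq_int denq_int.
case: eqVneq => [-> _|z0]; first by rewrite invr_ge0 exprn_ge0 ?ler0n.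
rewrite pfactor_dvdn ?absz_gt0 // => n_le; rewrite absz1 logn1 sub0r -exprnN.
by rewrite lef_pV2 ?posrE ?exprn_gt0 ?(lt_trans ltr01 q1) // ler_weXn2l // ltW.
Qed.

Lemma padic_abs_int_unit (z : int) : ~~ (q %| `|z|)%N -> abs z%:~R = 1.
Proof.
move=> qz; have z0 : z != 0 by apply: contraNneq qz => ->; rewrite dvdn0.
rewrite -ratr_int abs_rat /padic_abs intr_eq0 (negPf z0) numq_int denq_int.
by rewrite absz1 logn1 sub0r logn_coprime ?oppr0 ?expr0z // prime_coprime.
Qed.

(** Hensel lifting: for odd q, |2| = 1, so a nonzero square root modulo q is close enough to start
    Newton's iteration. *)
Lemma padic_sqrt_mod (z : int) (b : 'F_q) : q != 2 -> b != 0 -> b ^+ 2 = z%:~R ->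
  exists x : K, x ^+ 2 = z%:~R.
Proof.
move=> q2 b0 Eb; have Fq := pchar_Fp q_pr.
have dvd_q (y : int) : (q %| `|y|)%N = (y%:~R == 0 :> 'F_q).
  by case: y => n; rewrite ?NegzE ?abszN ?rmorphN ?oppr_eq0 (dvdn_pcharf Fq).
pose B : int := (b : nat)%:Z.
have EB : B%:~R = b by rewrite /B -pmulrn natr_Zp.
have abs2 : abs 2 = 1.
  apply: (@padic_abs_int_unit 2); rewrite /= dvdn_prime2 //.
apply: (@newton_sqrt B%:~R); rewrite ?abs2 ?expr1n //.
  by apply: padic_abs_int_unit; rewrite dvd_q EB.
rewrite -rmorphXn -rmorphB /=; apply: le_lt_trans (@padic_abs_int _ 1 _) _.
  by rewrite expn1 dvd_q rmorphB rmorphXn /= EB Eb subrr.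
by rewrite expr1 invf_lt1 ?ltr1n ?ltr0n ?prime_gt1 ?prime_gt0.
Qed.

Lemma padic_natr_neq0 n : (0 < n)%N -> (n%:R : K) != 0.
Proof.
move=> n0; apply/eqP => /abs_eq0/eqP; apply/negP.
rewrite -(ratr_nat K n) abs_rat /padic_abs pnatr_eq0 -if_neg -lt0n n0.
by rewrite expfz_neq0 // pnatr_eq0 -lt0n prime_gt0.
Qed.

End PadicSqrt.

(** Newton's iteration starts at 1, since |1 - p| <= 1/8 < 1/4 = |2|^2. *)
Lemma dyadic_sqrt (K : fieldType) (abs : K -> rat) (p : nat) :
  padic_completion 2 abs -> p = 1 %[mod 8] -> exists x : K, x ^+ 2 = p%:R.
Proof.
move=> K_2 p_mod8; have [[_ _ absM _] abs_rat _ _] := K_2.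
have abs2 : abs 2 = 2^-1.
  by rewrite -(ratr_nat K 2) abs_rat.
have abs1 : abs 1 = 1 by have := abs_rat 1%:R; rewrite ratr_nat.
apply: (@newton_sqrt 2 K abs _ K_2 1) => //; rewrite ?abs2 //.
have -> : 1 ^+ 2 - p%:R = (1 - p%:Z)%:~R :> K by rewrite expr1n rmorphB.
have dvd8 : (2 ^ 3 %| `|1 - p%:Z|)%N by lia.
by apply: le_lt_trans (padic_abs_int _ K_2 dvd8) _.
Qed.

(** * Squares in finite fields of odd order *)

Section FiniteFieldSquares.
Variables (F : finFieldType) (m : nat).
Hypothesis card_F : #|F| = m.*2.+1.
Implicit Types x y : F.

(** Translation by 1 permutes F, so the sum of 1 over F vanishes. *)
Let card_natr : m.*2.+1%:R = 0 :> F.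
Proof.
have : \sum_(x : F) (x + 1) = \sum_(x : F) x.
  by rewrite [RHS](reindex_inj (addIr 1)).
by rewrite big_split sumr_const cardT -cardE card_F -[RHS]addr0 => /addrI.
Qed.

Let two_neq0 : (2 : F) != 0.
Proof.
apply/eqP => two0; have /eqP := card_natr.
by rewrite -natr1 -muln2 natrM two0 mulr0 add0r oner_eq0.
Qed.

Let neg1_neq1 : (-1 : F) != 1.
Proof. by rewrite -subr_eq0 -opprD oppr_eq0. Qed.

Let exp_half x : x != 0 -> x ^+ m = 1 \/ x ^+ m = -1.
Proof.
move=> x0; have := expf_card x; rewrite card_F exprS -[RHS]mulr1 => /(mulfI x0).
rewrite -muln2 exprM => /eqP.
by rewrite sqrf_eq1 => /orP[] /eqP; [left | right].
Qed.

(** X^m - 1 has at most m roots among the 2 m nonzero elements; any other x has x^m = -1, and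
    x^(m/2) is the root sought. *)
Lemma sqrtN1_exists : ~~ odd m -> exists x, x ^+ 2 = -1.
Proof.
move=> m_even; have m0 : (0 < m)%N.
  have : (1 < #|F|)%N by apply/card_gt1P; exists 0, 1; rewrite eq_sym oner_neq0.
  by rewrite card_F; case: (m).
have [x x0 xm] : exists2 x : F, x != 0 & x ^+ m != 1.
  apply: contrapT => no_x; pose rs := enum (predC1 (0 : F)).
  have : (size rs < size ('X^m - 1 : {poly F})%R)%N.
    apply: max_poly_roots; last exact: enum_uniq.
      by rewrite -size_poly_eq0 size_XnsubC.
    apply/allP => x; rewrite mem_enum inE => x0.
    rewrite rootE !hornerE subr_eq0; apply: contrapT => /negP xm.
    by apply: no_x; exists x.
  by rewrite size_XnsubC // -cardE cardC1 card_F; lia.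
have {}xm : x ^+ m = -1.
  by have [xm1|//] := exp_half x0; rewrite xm1 eqxx in xm.
by exists (x ^+ m./2); rewrite -exprM muln2 even_halfK.
Qed.

Section Odd.
Hypothesis m_odd : odd m.

Lemma sqr_neqN1 x : x ^+ 2 != -1.
Proof.
apply/eqP => x2; have x0 : x != 0 by rewrite -sqrf_eq0 x2 oppr_eq0 oner_eq0.
have : x ^+ 2 ^+ m = 1.
  by rewrite -exprM mulnC exprM; have [->|->] := exp_half x0; rewrite ?sqrrN expr1n.
by rewrite x2 -signr_odd m_odd => /eqP; rewrite (negPf neg1_neq1).
Qed.

(** Since m + 1 is even, x^(m+1) is a square, and it equals x or - x. *)
Lemma sqr_or_oppr x : (exists y, x = y ^+ 2) \/ (exists y, - x = y ^+ 2).
Proof.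
have [->|x0] := eqVneq x 0; first by left; exists 0; rewrite expr0n.
have halfS : (m.+1./2 * 2 = m.+1)%N by lia.
have [xm|xm] := exp_half x0; [left | right].
  by exists (x ^+ m.+1./2); rewrite -exprM halfS exprS xm mulr1.
exists ((- x) ^+ m.+1./2); rewrite -exprM halfS exprS exprNn xm -signr_odd m_odd.
by rewrite mulrNN !mulr1.
Qed.

(** Otherwise adding 1 would preserve squares, so 2 m = -1 would be a square, against
    [sqr_neqN1]. *)
Lemma sqr_succ_nonsqr : exists2 s, s != 0 & forall y, 1 + s ^+ 2 != y ^+ 2.
Proof.
apply: contrapT => no_s.
have natr_sqr n : exists y, n%:R = y ^+ 2 :> F.
  elim: n => [|n [y Ey]]; first by exists 0; rewrite expr0n.
  have [y0|y0] := eqVneq y 0; first by exists 1; rewrite -natr1 Ey y0 expr0n add0r expr1n.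
  apply: contrapT => no_z; apply: no_s; exists y => // z; apply/eqP => Ez.
  by apply: no_z; exists z; rewrite -Ez -natr1 Ey addrC.
have [y Ey] := natr_sqr m.*2; have := sqr_neqN1 y; rewrite -Ey.
by rewrite -addr_eq0 natr1 card_natr eqxx.
Qed.

(** Write x = - n^2 and choose s with 1 + s^2 = - w^2. Then t = n s makes x - t^2 the square of n w,
    and x + t^2 = n^2 (s^2 - 1). *)
Lemma sqr_sub_add_exists x : (forall y, x != y ^+ 2) ->
  exists t u v, [/\ t != 0, u != 0, x - t ^+ 2 = u ^+ 2 & x + t ^+ 2 = v ^+ 2].
Proof.
move=> x_nsqr; have x0 : x != 0 by have := x_nsqr 0; rewrite expr0n.
have [[y Ey]|[n Ex]] := sqr_or_oppr x; first by have := x_nsqr y; rewrite Ey eqxx.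
have {}Ex : x = - n ^+ 2 by rewrite -Ex opprK.
have n0 : n != 0 by move: x0; rewrite Ex oppr_eq0 sqrf_eq0.
have [s s0 s_nsqr] := sqr_succ_nonsqr.
have [[y Ey]|[w Ew]] := sqr_or_oppr (1 + s ^+ 2); first by have := s_nsqr y; rewrite Ey eqxx.
have w0 : w != 0.
  rewrite -sqrf_eq0 -Ew oppr_eq0; apply: contra (s_nsqr 0) => /eqP->.
  by rewrite expr0n.
have [[k Ek]|[k Ek]] := sqr_or_oppr (s ^+ 2 - 1).
  exists (n * s), (n * w), (n * k); rewrite !mulf_neq0 //; split=> //.
    by rewrite Ex (exprMn _ n w) -Ew; ring.
  by rewrite Ex (exprMn _ n k) -Ek; ring.
(* If 1 - s^2 is the square instead, replace s by 1 / s: this keeps the class of 1 + s^2 and changes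
   the sign of that of s^2 - 1. *)
exists (n / s), (n * w / s), (n * k / s); rewrite !mulf_neq0 ?invr_eq0 //; split=> //.
  by rewrite Ex !expr_div_n (exprMn _ n w) -Ew; field.
by rewrite Ex !expr_div_n (exprMn _ n k) -Ek; field.
Qed.

End Odd.
End FiniteFieldSquares.

(** * Triviality of the cocycle at every place *)

Lemma sqrt_cocycle_locally_trivial (p : nat) : prime p -> p = 1 %[mod 8] ->
  everywhere_locally_trivial (E_ p) (sqrt_cocycle p).
Proof.
move=> p_pr p_mod8; have p_gt0 := prime_gt0 p_pr; split=> [R | q K abs q_pr K_q].
  by apply: (@trivial_over_sqrt p R (Num.sqrt p%:R)); rewrite sqr_sqrtr ?ler0n.
have [q2|q2] := eqVneq q 2.
  by move: K_q; rewrite q2 => /dyadic_sqrt/(_ p_mod8)[k]; apply: trivial_over_sqrt.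
have [m Em] : exists m, q = m.*2.+1.
  by have [Eq|q_odd] := even_prime q_pr; [rewrite Eq eqxx in q2 | exists q./2; lia].
have lift z (b : 'F_q) := @padic_sqrt_mod q K abs q_pr K_q z b q2.
have card_Fq : #|'F_q| = m.*2.+1 by rewrite card_Fp.
(* [m] is even exactly when q = 1 mod 4; for odd [m], q differs from p because p = 1 mod 8. *)
have [m_odd|m_even] := boolP (odd m); last first.
  have [b Eb] := sqrtN1_exists card_Fq m_even.
  have b0 : b != 0 by rewrite -sqrf_eq0 Eb oppr_eq0 oner_eq0.
  have [|k Ek] := lift (-1) b b0; first by rewrite Eb.
  by apply: (@trivial_over_sqrtN1 p p_gt0 K k); rewrite Ek.
have pq : (p%:R : 'F_q) != 0.
  rewrite -(dvdn_pcharf (pchar_Fp q_pr)) dvdn_prime2 //; apply: contraTneq m_odd => qp.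
  by move: p_mod8; rewrite -qp Em; lia.
have [[b Eb]|nsqr] := pselect (exists b : 'F_q, p%:R = b ^+ 2).
  have b0 : b != 0 by move: pq; rewrite Eb sqrf_eq0.
  have [|k Ek] := lift p b b0; first by rewrite -Eb.
  by apply: (@trivial_over_sqrt p K k).
have [|t [u [v [t0 u0 Eu Ev]]]] := sqr_sub_add_exists card_Fq m_odd (x := p%:R).
  by move=> y; apply: contra_notN nsqr => /eqP Ey; exists y.
(* A zero root cannot be lifted. But v = 0 makes - p and 2 p nonzero squares modulo q; lifting their
   roots to k and l gives p - k^2 = l^2 and p + k^2 = 0. *)
have [v0|v0] := eqVneq v 0.
  have Et : t ^+ 2 = (- p%:Z)%:~R.
    by rewrite rmorphN; apply/eqP; rewrite -addr_eq0 addrC Ev v0 expr0n.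
  have [k Ek] := lift _ _ t0 Et.
  have E2p : u ^+ 2 = (2 * p%:Z)%:~R by rewrite -Eu Et !rmorphM rmorphN /=; ring.
  have [l El] := lift _ _ u0 E2p.
  have pK : (p%:R : K) != 0 by apply: (padic_natr_neq0 q_pr K_q).
  apply: (@trivial_over_squares p p_gt0 K k l 0).
  - by rewrite -sqrf_eq0 Ek rmorphN oppr_eq0.
  - by rewrite Ek El rmorphM rmorphN /=; ring.
  - by rewrite Ek rmorphN /= subrr expr0n.
pose T : nat := t; have ET : T%:R = t by rewrite natr_Zp.
have [|k Ek] := lift (p%:Z - T%:Z ^+ 2) u u0.
  by rewrite -Eu rmorphB rmorphXn /= -ET.
have [|l El] := lift (p%:Z + T%:Z ^+ 2) v v0.
  by rewrite -Ev rmorphD rmorphXn /= -ET.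
apply: (@trivial_over_squares p p_gt0 K T%:R k l).
- apply: (padic_natr_neq0 q_pr K_q); rewrite lt0n; apply: contraNneq t0 => T0.
  by rewrite -ET T0.
- by rewrite Ek rmorphB rmorphXn.
- by rewrite El rmorphD rmorphXn.
Qed.

(** * The case of rank 2 *)

(** By hypothesis [D] separates the classes modulo doubles, of which there are 2^r #T[2], at least
    as many as elements of X; so no value is missed. The count is done on the finite set {0, 1}^r x
    T. *)
Lemma surj_of_eq_mod_double (r : nat) (T : finZmodType) (X : finType)
    (D : 'rV[int]_r * T -> X) :
  (forall u v, D u = D v -> exists w, u - v = w + w) ->
  (#|X| <= 2 ^ r * #|[set t : T | t + t == 0]%R|)%N ->
  forall d, exists u, D u = d.
Proof.
move=> D_double leX d; apply: contrapT => no_u.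
set K := [set t : T | t + t == 0] in leX.
pose I := [set t + t | t : T].
(* Doubling on T has kernel [K] and image [I]; a section [half] of it embeds K x I in T. *)
have leKI : (#|K| * #|I| <= #|T|)%N.
  pose half i := odflt 0 [pick t : T | t + t == i].
  have halfP i : i \in I -> half i + half i = i.
    move=> /imsetP[t _ ->]; rewrite /half; case: pickP => [s /eqP //|].
    by move/(_ t); rewrite eqxx.
  rewrite -cardsX -(@card_in_imset _ _ (fun ki => ki.1 + half ki.2)) ?max_card //.
  move=> [k i] [k' i']; rewrite !inE /= => /andP[/eqP Ek iI] /andP[/eqP Ek' iI'] Eki.
  have : (k + half i) + (k + half i) = (k' + half i') + (k' + half i') by rewrite Eki.
  rewrite !(addrACA _ (half _)) Ek Ek' !halfP // !add0r => Ei.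
  by move: Eki; rewrite Ei => /addIr->.
pose B := ({ffun 'I_r -> bool} * T)%type.
pose rep (b : B) : 'rV[int]_r * T := (\row_j (b.1 j : nat)%:Z, b.2).
pose fib x := [set b : B | D (rep b) == x].
have le_fib x : (#|fib x| <= #|I|)%N.
  have [->|[b0]] := set_0Vmem (fib x); first by rewrite cards0.
  rewrite inE => /eqP Db0.
  (* Two 0-1 vectors whose difference is a double are equal, so a fibre varies only in T, by an
     element of [I]. *)
  have fibP b : b \in fib x -> b.1 = b0.1 /\ b.2 - b0.2 \in I.
    rewrite inE => /eqP Db; have [|w [Ew1 Ew2]] := D_double (rep b) (rep b0).
      by rewrite Db Db0.
    split; last by rewrite Ew2; apply: imset_f.
    apply/ffunP => j; have /matrixP/(_ 0 j) := Ew1; rewrite !mxE.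
    by case: (b.1 j) (b0.1 j) => [] [] //; lia.
  rewrite -(@card_in_imset _ _ (fun b : B => b.2 - b0.2)).
    by apply/subset_leq_card/subsetP => _ /imsetP[b /fibP[_ bI] ->].
  by move=> [a s] [b t] /fibP[/= -> _] /fibP[/= -> _] /addIr->.
have cardB : #|{: B}| = (\sum_x #|fib x|)%N.
  rewrite -sum1_card (partition_big (fun b => D (rep b)) predT) //=.
  by apply: eq_bigr => x _; rewrite -sum1_card; apply: eq_bigl => b; rewrite inE.
have fib_d : #|fib d| = 0%N.
  apply/eqP; rewrite cards_eq0 -subset0; apply/subsetP => b; rewrite inE => /eqP Eb.
  by case: no_u; exists (rep b).
have leB : (#|{: B}| <= #|X|.-1 * #|I|)%N.
  rewrite cardB (bigD1 d) //= fib_d add0n.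
  apply: leq_trans (leq_sum _ _) _; first by move=> x _; apply: le_fib.
  by rewrite sum_nat_const cardC1.
have I_gt0 : (0 < #|I|)%N by apply/card_gt0P; exists (0 + 0); apply: imset_f.
have X_gt0 : (0 < #|X|)%N by apply/card_gt0P; exists d.
have : (#|X| * #|I| <= #|X|.-1 * #|I|)%N.
  apply: leq_trans leB; rewrite card_prod card_ffun card_bool card_ord.
  apply: leq_trans (leq_mul leX (leqnn _)) _.
  by rewrite -mulnA leq_mul2l leKI orbT.
by rewrite leq_pmul2r //; lia.
Qed.

(** * Complete 2-descent on E_p *)

Section Descent.
Variable p : nat.
Hypothesis p_pr : prime p.
Local Notation P := (p%:R : rat).

Let P_gt0 : 0 < P. Proof. by rewrite ltr0n prime_gt0. Qed.
Let P_neq0 : P != 0. Proof. by rewrite gt_eqF. Qed.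

(* The class of x - e modulo squares, extended to the 2-torsion points so as to be
   additive; [3 e^2 - p^2] is the derivative of the cubic at its root e. *)
Definition root_class (e : rat) (Q : point rat) : rat :=
  if Q is Some (x, _) then if x == e then 3 * e ^+ 2 - P ^+ 2 else x - e else 1.

(** These two relations hold for chords and tangents alike, so the Vieta argument needs no case
    distinction. The second is the difference of the curve equations divided by x2 - x1. *)
Lemma chord_slopeP (x1 y1 x2 y2 : rat) :
    on_curve (E_ p) (Some (x1, y1)) -> on_curve (E_ p) (Some (x2, y2)) ->
    ~~ ((x1 == x2) && (y1 == - y2)) ->
  let l := if x1 == x2 then (3 * x1 ^+ 2 - P ^+ 2) / (2 * y1)
           else (y2 - y1) / (x2 - x1) in
  y2 - y1 = l * (x2 - x1) /\
  x1 ^+ 2 + x1 * x2 + x2 ^+ 2 - P ^+ 2 = l * (y1 + y2).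
Proof.
move=> /on_curveE E1 /on_curveE E2; have [Ex|nx] := eqVneq x1 x2.
  move: E1; rewrite Ex /= => E1 ny.
  have Ey : y1 = y2.
    have /eqP : y1 ^+ 2 = y2 ^+ 2 by rewrite E1 E2.
    by rewrite eqf_sqr (negPf ny) orbF => /eqP.
  have y0 : y2 != 0 by apply: contraNneq ny => y0; rewrite Ey y0 oppr0.
  by rewrite Ey; split; [ring | field].
move=> _ /=; have x21 : x2 - x1 != 0 by rewrite subr_eq0 eq_sym.
split; first by rewrite divfK.
apply: (mulIf x21); transitivity (y2 ^+ 2 - y1 ^+ 2); first by rewrite E1 E2; ring.
by field.
Qed.

(* Vieta: if [X1], [X2], [X3] are the roots of X^3 + 3 e X^2 + b X - (l X + d)^2
   then X1 X2 X3 = d^2 and X1 X2 + X1 X3 + X2 X3 = b - 2 l d. *)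
Lemma root_class_add (e : rat) (Q R : point rat) :
    e ^+ 3 = P ^+ 2 * e -> 3 * e ^+ 2 != P ^+ 2 ->
    on_curve (E_ p) Q -> on_curve (E_ p) R ->
  exists c, root_class e Q * root_class e R * root_class e (add_point (E_ p) Q R) = c ^+ 2.
Proof.
move=> Ee; rewrite -subr_eq0; case: Q R => [[x1 y1]|] [[x2 y2]|] b0 onQ onR; last first.
- by exists 1; rewrite /= !mulr1 expr1n.
- by exists (root_class e (Some (x2, y2))); rewrite /add_point /= mul1r expr2.
- by exists (root_class e (Some (x1, y1))); rewrite /add_point /= mulr1 expr2.
rewrite /add_point; case: ifPn => [/andP[/eqP -> _]|nQR].
  by exists (root_class e (Some (x2, y2))); rewrite /= mulr1 expr2.
have := chord_slopeP onQ onR nQR; rewrite ratr_coef_a; set l := (if _ then _ else _) => -[El1 El2].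
set x3 := l ^+ 2 - x1 - x2.
pose X1 := x1 - e; pose X2 := x2 - e; pose X3 := x3 - e; pose d := y1 - l * X1.
set b := 3 * e ^+ 2 - P ^+ 2 in b0.
have /on_curveE E1 := onQ.
have V2 : X1 * X2 + X1 * X3 + X2 * X3 = b - 2 * l * d.
  transitivity ((l ^+ 2 * (X1 + X2) - (x1 ^+ 2 + x1 * x2 + x2 ^+ 2 - P ^+ 2)) + b).
    by rewrite /X1 /X2 /X3 /x3 /b; ring.
  rewrite El2; have -> : y2 = y1 + l * (x2 - x1) by rewrite -El1; ring.
  by rewrite /d /X1 /X2; ring.
have Vb : b = X1 * X2 + X1 * X3 + X2 * X3 + 2 * l * d by rewrite V2; ring.
have V3 : X1 * X2 * X3 = d ^+ 2.
  have E2ld : 2 * l * d = b - (X1 * X2 + X1 * X3 + X2 * X3) by rewrite V2; ring.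
  have -> : d ^+ 2 = y1 ^+ 2 - l ^+ 2 * X1 ^+ 2 - 2 * l * d * X1 by rewrite /d; ring.
  rewrite E2ld E1 (_ : x1 ^+ 3 - P ^+ 2 * x1 =
    X1 ^+ 3 + 3 * e * X1 ^+ 2 + b * X1 + (e ^+ 3 - P ^+ 2 * e)).
    by rewrite Ee /X3 /x3 /X1 /X2; ring.
  by rewrite /X1 /b; ring.
have gE x : (if x == e then b else x - e) = if x - e == 0 then b else x - e.
  by rewrite subr_eq0.
rewrite /= -/b !gE -/X1 -/X2 -/X3.
have d0 : [|| X1 == 0, X2 == 0 | X3 == 0] -> d = 0.
  by rewrite orbA -!mulf_eq0 V3 sqrf_eq0 => /eqP.
(* If one Xi vanishes then d = 0 and the other two have product b, which is also the class given to
   the vanishing one; the triple product is b^2. *)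
have [X10|X10] := eqVneq X1 0.
  have Eb : X2 * X3 = b by rewrite Vb d0 ?X10 ?eqxx ?orbT //; ring.
  have : X2 * X3 != 0 by rewrite Eb.
  rewrite mulf_eq0 => /norP[/negPf-> /negPf->]; exists b.
  by rewrite -mulrA Eb expr2.
have [X20|X20] := eqVneq X2 0.
  have Eb : X1 * X3 = b by rewrite Vb d0 ?X20 ?eqxx ?orbT //; ring.
  have : X1 * X3 != 0 by rewrite Eb.
  rewrite mulf_eq0 => /norP[_ /negPf->]; exists b.
  by rewrite mulrAC Eb expr2.
have [X30|X30] := eqVneq X3 0; last by exists d.
have Eb : X1 * X2 = b by rewrite Vb d0 ?X30 ?eqxx ?orbT //; ring.
by exists b; rewrite Eb expr2.
Qed.

Lemma root_class_neq0 (e : rat) (Q : point rat) :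
  3 * e ^+ 2 != P ^+ 2 -> root_class e Q != 0.
Proof.
move=> b0; case: Q => [[x y]|] /= ; last by [].
by case: (eqVneq x e) => [_|ne]; rewrite subr_eq0.
Qed.

(** The third factor x - p is a square too. With roots r1, r2, r3 of product y, the half has
    abscissa (r1 + r2)(r1 + r3) and its tangent has slope r1 + r2 + r3. *)
Lemma exists_half (x y r1 r3 : rat) : y != 0 -> on_curve (E_ p) (Some (x, y)) ->
    x = r1 ^+ 2 -> x + P = r3 ^+ 2 ->
  exists Q, on_curve (E_ p) Q /\ add_point (E_ p) Q Q = Some (x, y).
Proof.
move=> y0 /on_curveE Exy Er1 Er3.
have r10 : r1 != 0.
  by apply: contraNneq y0 => r10; rewrite -sqrf_eq0 Exy Er1 r10 !expr0n /= mulr0 subrr.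
have r30 : r3 != 0.
  apply: contraNneq y0 => r30; rewrite -sqrf_eq0 Exy.
  have -> : x = - P by apply/eqP; rewrite -addr_eq0 Er3 r30 expr0n.
  by apply/eqP; ring.
pose r2 := y / (r1 * r3).
have Er2 : x - P = r2 ^+ 2.
  rewrite expr_div_n Exy exprMn -Er1 -Er3.
  have x0 : x != 0 by rewrite Er1 sqrf_eq0.
  have xP0 : x + P != 0 by rewrite Er3 sqrf_eq0.
  by field; rewrite ?x0 ?xP0.
have Ey : y = r1 * r2 * r3 by rewrite /r2; field; nonzero.
have P2 : 2 * P != 0 by rewrite mulf_neq0.
have sum_neq0 (u v c : rat) : c != 0 -> u ^+ 2 - v ^+ 2 = c -> u + v != 0.
  by move=> c0 Ec; apply: contraNneq c0 => uv0; rewrite -Ec subr_sqr uv0 mulr0.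
have r12 : r1 + r2 != 0 by apply: (sum_neq0 _ _ P) => //; rewrite -Er1 -Er2; ring.
have r31 : r1 + r3 != 0 by rewrite addrC; apply: (sum_neq0 _ _ P) => //; rewrite -Er1 -Er3; ring.
have r32 : r2 + r3 != 0 by rewrite addrC; apply: (sum_neq0 _ _ (2 * P)) => //;
  rewrite -Er2 -Er3; ring.
(* r1, r2, r3 are square roots of x, x - p, x + p with product y. *)
pose X := (r1 + r2) * (r1 + r3); pose Y := X * (r2 + r3).
have Y0 : Y != 0 by rewrite !mulf_neq0.
have E12 : P = r1 ^+ 2 - r2 ^+ 2 by rewrite -Er1 -Er2; ring.
have E31 : P = r3 ^+ 2 - r1 ^+ 2 by rewrite -Er1 -Er3; ring.
have EP2 : P ^+ 2 = (r1 ^+ 2 - r2 ^+ 2) * (r3 ^+ 2 - r1 ^+ 2).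
  by rewrite -Er1 -Er2 -Er3; ring.
have Esum : r2 ^+ 2 + r3 ^+ 2 = 2 * r1 ^+ 2 by rewrite -Er1 -Er2 -Er3; ring.
exists (Some (X, Y)); split.
  apply/on_curveE.
  transitivity (X * ((X - P) * (X + P))); last by ring.
  have -> : X - P = (r1 + r2) * (r2 + r3).
    by rewrite E12 /X; ring.
  have -> : X + P = (r1 + r3) * (r2 + r3).
    by rewrite E31 /X; ring.
  by rewrite /Y /X; ring.
have nYY : Y == - Y = false by apply/negbTE; rewrite -addr_eq0 -mulr2n -mulr_natl mulf_neq0.
rewrite /= eqxx nYY /= ratr_coef_a.
have -> : (3 * X ^+ 2 - P ^+ 2) / (2 * Y) = r1 + r2 + r3.
  apply: (canLR (mulfK _)); first by rewrite mulf_neq0.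
  have Er32 : r3 ^+ 2 = 2 * r1 ^+ 2 - r2 ^+ 2 by rewrite -Esum; ring.
  apply/eqP; rewrite -subr_eq0; apply/eqP.
  transitivity (2 * X * (2 * r1 ^+ 2 - r2 ^+ 2 - r3 ^+ 2)); last by rewrite Er32; ring.
  by rewrite EP2 /Y /X; ring.
have Ex3 : (r1 + r2 + r3) ^+ 2 - X - X = x.
  rewrite Er1 /X; transitivity (r2 ^+ 2 + r3 ^+ 2 - r1 ^+ 2); first by ring.
  by rewrite Esum; ring.
by rewrite Ex3 Ey Er1 /Y /X; congr (Some (_, _)); ring.
Qed.

(** For x = m / n in lowest terms, n m (m - p n)(m + p n) is a square. A prime other than p divides
    at most one factor, except that 2 may divide both of the last two. *)
Lemma even_val_classes (q : nat) (x y : rat) : prime q -> q != p -> y != 0 ->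
    on_curve (E_ p) (Some (x, y)) ->
  odd_val q x = false /\ (q != 2 -> odd_val q (x + P) = false).
Proof.
move=> q_pr qp y0 /on_curveE Exy.
set m := numq x; set n := denq x.
have n0 : n%:~R != 0 :> rat by rewrite intr_eq0 denq_neq0.
have Em : x * n%:~R = m%:~R by rewrite -numqE.
pose c := m - p%:Z * n; pose d := m + p%:Z * n.
have Ec : (x - P) * n%:~R = c%:~R by rewrite rmorphB rmorphM /= -Em; ring.
have Ed : (x + P) * n%:~R = d%:~R by rewrite rmorphD rmorphM /= -Em; ring.
have Esq : (y * n%:~R ^+ 2) ^+ 2 = (n * m * (c * d))%:~R.
  by rewrite !rmorphM /= -Ec -Ed -Em exprMn Exy; ring.
have : (n * m * (c * d))%:~R != 0 :> rat by rewrite -Esq sqrf_eq0 mulf_neq0 ?expf_neq0.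
rewrite intr_eq0 !mulf_eq0 => /norP[/norP[n0' m0] /norP[c0 d0]].
have even_sum : odd (logn q `|n| + logn q `|m| + (logn q `|c| + logn q `|d|)) = false.
  rewrite -!lognM ?muln_gt0 ?absz_gt0 ?m0 ?n0' ?c0 ?d0 //.
  rewrite -!abszM -(@odd_valE q (n * m * (c * d))%:~R _ 1) ?expr1n ?mulr1
    ?intr_eq0 ?mulf_neq0 //.
  by rewrite -Esq odd_val_sqr.
have x0 : x != 0 by rewrite -numq_eq0.
have xP0 : x + P != 0.
  by apply: contraNneq d0 => xP0; rewrite -(intr_eq0 rat) -Ed xP0 mul0r.
have ox : odd_val q x = odd (logn q `|m| + logn q `|n|).
  by rewrite -lognM ?absz_gt0.
have oxP : odd_val q (x + P) = odd (logn q `|d| + logn q `|n|).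
  rewrite -lognM ?absz_gt0 // -abszM; apply: (@odd_valE q _ _ n) => //.
  by rewrite expr2 mulrA Ed rmorphM.
have logn0q z : ~~ (q %| z)%Z -> logn q `|z| = 0%N.
  by rewrite dvdzE => qz; rewrite logn_coprime ?prime_coprime.
have qp' : ~~ (q %| p%:Z)%Z by rewrite dvdzE /= dvdn_prime2.
have dvdM (a b : int) : (q %| a * b)%Z = (q %| a)%Z || (q %| b)%Z.
  by rewrite !dvdzE abszM Euclid_dvdM.
have cop : ~~ ((q %| m)%Z && (q %| n)%Z).
  rewrite !dvdzE -dvdn_gcd; have := coprime_num_den x; rewrite /coprime -/m -/n => /eqP ->.
  by rewrite dvdn1 neq_ltn prime_gt1 ?orbT.
rewrite ox oxP.
have [qn|qn] := boolP (q %| n)%Z.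
  have qpn : (q %| p%:Z * n)%Z by rewrite dvdM qn orbT.
  have qm : ~~ (q %| m)%Z by move: cop; rewrite qn andbT.
  have qc : ~~ (q %| c)%Z by rewrite rpredBr.
  have qd : ~~ (q %| d)%Z by rewrite rpredDr.
  by move: even_sum; rewrite (logn0q m) // (logn0q c) // (logn0q d) // !addn0.
rewrite (logn0q n) // !addn0; rewrite (logn0q n) // add0n in even_sum.
have qpn : ~~ (q %| p%:Z * n)%Z by rewrite dvdM negb_or qp'.
have [qm|qm] := boolP (q %| m)%Z.
  have qc : ~~ (q %| c)%Z by rewrite rpredBl.
  have qd : ~~ (q %| d)%Z by rewrite rpredDl.
  by move: even_sum; rewrite (logn0q c) // (logn0q d) // !addn0.
rewrite (logn0q m) // add0n in even_sum *; split=> // q2.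
have [qd|qd] := boolP (q %| d)%Z; last by rewrite logn0q.
have qc : ~~ (q %| c)%Z.
  apply/negP => qc; have : (q %| (2 : int) * m)%Z.
    have -> : 2 * m = c + d by rewrite /c /d; ring.
    exact: rpredD.
  by rewrite dvdM (negPf qm) orbF dvdzE /= dvdn_prime2 // (negPf q2).
by move: even_sum; rewrite (logn0q c).
Qed.

Let odd_val_p q : prime q -> odd_val q P = (q == p).
Proof. by move=> q_pr; rewrite odd_val_nat logn_prime // eq_sym; case: eqP. Qed.

Let P_root : P ^+ 3 = P ^+ 2 * P. Proof. by rewrite exprSr. Qed.
Let NP_root : (- P) ^+ 3 = P ^+ 2 * - P. Proof. by ring. Qed.
Let root0 : 0 ^+ 3 = P ^+ 2 * 0. Proof. by rewrite mulr0 expr0n. Qed.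
Let root0_simple : 3 * 0 ^+ 2 != P ^+ 2.
Proof. by rewrite expr0n mulr0 eq_sym expf_neq0. Qed.
Let NP_simple : 3 * (- P) ^+ 2 != P ^+ 2.
Proof.
rewrite -subr_eq0 (_ : _ - _ = 2 * P ^+ 2); last by ring.
by rewrite mulf_neq0 ?expf_neq0.
Qed.

Lemma on_curve_y0 (x : rat) : on_curve (E_ p) (Some (x, 0)) -> [\/ x = 0, x = P | x = - P].
Proof.
move=> /on_curveE Ex; have /eqP : x * ((x - P) * (x + P)) = 0.
  by transitivity (0 ^+ 2 : rat); [rewrite Ex; ring | rewrite expr0n].
rewrite !mulf_eq0 subr_eq0 addr_eq0.
by move=> /or3P[] /eqP; [constructor 1 | constructor 2 | constructor 3].
Qed.

(** Away from 2-torsion, the valuations come from [even_val_classes], and the sign from x (x - p)(x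
    + p) > 0, which forces x > - p. The 2-torsion points are computed directly. *)
Lemma root_class_Selmer (Q : point rat) : on_curve (E_ p) Q ->
  [/\ forall q, prime q -> q != p -> odd_val q (root_class 0 Q) = false,
      forall q, prime q -> q != p -> q != 2 -> odd_val q (root_class (- P) Q) = false
    & 0 < root_class (- P) Q].
Proof.
case: Q => [[x y]|] onQ; last first.
  by split=> // q *; rewrite (odd_val_nat q 1) logn1.
have [y0|y0] := eqVneq y 0.
  have P2 : P ^+ 2 > 0 by rewrite exprn_gt0.
  have NPP : - P == P = false by rewrite -subr_eq0 -opprD oppr_eq0 -mulr2n mulrn_eq0 (negPf P_neq0).
  have oP q : prime q -> q != p -> odd_val q P = false by move=> q_pr /negPf; rewrite odd_val_p.
  have o2P q : prime q -> q != p -> q != 2 -> odd_val q (2 * P) = false.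
    move=> q_pr qp q2; rewrite odd_valM // oP // (odd_val_nat q 2) logn_prime //.
    by rewrite (negPf q2).
  move: onQ; rewrite y0 => /on_curve_y0[] -> /=.
  - rewrite ?eqxx expr0n mulr0 sub0r eq_sym oppr_eq0 (negPf P_neq0) opprK add0r.
    by split=> // q q_pr qp; [rewrite odd_valN odd_val_sqr | rewrite oP].
  - rewrite (negPf P_neq0) subr0 eq_sym NPP opprK (_ : P + P = 2 * P); last by ring.
    by split=> [q q_pr qp|q q_pr qp q2|]; [rewrite oP | rewrite o2P | rewrite mulr_gt0].
  - rewrite oppr_eq0 (negPf P_neq0) subr0 eqxx.
    have -> : 3 * (- P) ^+ 2 - P ^+ 2 = 2 * P ^+ 2 by ring.
    split=> [q q_pr qp | q q_pr qp q2 |]; first by rewrite odd_valN oP.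
      rewrite odd_valM ?expf_neq0 // odd_val_sqr (odd_val_nat q 2) logn_prime //.
      by rewrite (negPf q2).
    by rewrite mulr_gt0.
have /on_curveE Exy := onQ.
have fx : x * (x - P) * (x + P) > 0.
  have : 0 < y ^+ 2 by rewrite exprn_even_gt0.
  by rewrite Exy; congr (_ < _); ring.
have x0 : x != 0 by apply: contraTneq fx => ->; rewrite !mul0r ltxx.
have xP0 : x + P != 0 by apply: contraTneq fx => ->; rewrite mulr0 ltxx.
have nxP : x == - P = false by rewrite -addr_eq0 (negPf xP0).
rewrite /= (negPf x0) nxP subr0 opprK; split=> [q q_pr qp | q q_pr qp q2 |].
- by have [] := even_val_classes q_pr qp y0 onQ.
- by have [_ ->] := even_val_classes q_pr qp y0 onQ.
- rewrite lt_def xP0 leNgt; apply/negP => xP.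
  move: fx; rewrite ltNge => /negP; apply; rewrite nmulr_lle0 //.
  by have P0 := P_gt0; rewrite mulr_le0 //; lra.
Qed.

(* The four coordinates that are not forced to vanish by the local conditions at
   the other primes. *)
Definition selmer_class (Q : point rat) : bool * bool * bool * bool :=
  (root_class 0 Q < 0, odd_val p (root_class 0 Q),
   odd_val 2 (root_class (- P) Q), odd_val p (root_class (- P) Q)).

(** S = Q - R has trivial class by additivity, so both of its root classes are squares and it can be
    halved. *)
Lemma selmer_class_half (Q R S : point rat) :
    on_curve (E_ p) Q -> on_curve (E_ p) R -> on_curve (E_ p) S ->
    add_point (E_ p) S R = Q -> selmer_class Q = selmer_class R ->
  exists2 H, on_curve (E_ p) H & add_point (E_ p) H H = S.
Proof.
move=> onQ onR onS ESR [sgn0 val0 val2 valp].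
have [g0 Eg0] := root_class_add root0 root0_simple onS onR; rewrite ESR in Eg0.
have [g1 Eg1] := root_class_add NP_root NP_simple onS onR; rewrite ESR in Eg1.
have nz0 T := root_class_neq0 T root0_simple.
have nz1 T := root_class_neq0 T NP_simple.
have [ev0 ev1 S1] := root_class_Selmer onS.
have ov0 q : odd_val q (root_class 0 Q) = odd_val q (root_class 0 R) ->
    odd_val q (root_class 0 S) = false.
  have := odd_val_sqr q g0; rewrite -Eg0 !odd_valM ?mulf_neq0 // => + E.
  by rewrite E -addbA addbb addbF.
have ov1 q : odd_val q (root_class (- P) Q) = odd_val q (root_class (- P) R) ->
    odd_val q (root_class (- P) S) = false.
  have := odd_val_sqr q g1; rewrite -Eg1 !odd_valM ?mulf_neq0 // => + E.
  by rewrite E -addbA addbb addbF.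
have S0 : 0 < root_class 0 S.
  have : 0 <= root_class 0 S * (root_class 0 R * root_class 0 Q) by rewrite mulrA Eg0 sqr_ge0.
  have RQ : 0 < root_class 0 R * root_class 0 Q.
    have := nz0 Q; have := nz0 R; move: sgn0.
    case: (ltgtP (root_class 0 Q) 0) => [Q0|Q0|->]; rewrite ?eqxx //;
      case: (ltgtP (root_class 0 R) 0) => [R0|R0|->]; rewrite ?eqxx // => _ _ _.
      by rewrite nmulr_rgt0.
    by rewrite mulr_gt0.
  by rewrite pmulr_lge0 // le0r (negPf (nz0 S)).
have [r1 Er1] : exists r, root_class 0 S = r ^+ 2.
  apply: rat_squareP => // q q_pr; have [->|qp] := eqVneq q p; last exact: ev0.
  exact: ov0.
have [r3 Er3] : exists r, root_class (- P) S = r ^+ 2.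
  apply: rat_squareP => // q q_pr; have [->|qp] := eqVneq q p; first exact: ov1.
  by have [->|q2] := eqVneq q 2; [exact: ov1 | exact: ev1].
case: S onS S0 Er1 S1 Er3 {ESR Eg0 Eg1 ev0 ev1 ov0 ov1} => [[x y]|] onS; last by exists None.
(* S is not a nonzero 2-torsion point: the class at 0 is negative for (0, 0) and (- p, 0), and is
   the nonsquare p for (p, 0). *)
have NP2 : 0 <= P ^+ 2 by rewrite sqr_ge0.
rewrite /=; case: eqVneq => [_|x0].
  by rewrite expr0n mulr0 sub0r oppr_gt0 ltNge NP2.
rewrite subr0 => x_gt0 Er1; case: eqVneq => [Ex|nxP].
  by move: x_gt0; rewrite Ex oppr_gt0 ltNge ltW.
rewrite opprK => xP Er3; have y0 : y != 0.
  apply/eqP => y0; move: onS; rewrite y0 => /on_curve_y0[] Ex.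
  - by rewrite Ex eqxx in x0.
  - by have := rat_sqr_neq_prime r1 p_pr; rewrite -Er1 Ex eqxx.
  - by rewrite Ex eqxx in nxP.
by have [H [onH EH]] := exists_half y0 onS Er1 Er3; exists H.
Qed.

Lemma reflecting_of_selmer_class (Q : point rat) : p != 2 -> on_curve (E_ p) Q ->
  selmer_class Q = (false, false, false, true) -> reflecting_congruent_number p%:Z.
Proof.
move=> p2 onQ [sgn0 val0 val2 valp].
have nz0 := root_class_neq0 Q root0_simple.
have nz1 := root_class_neq0 Q NP_simple.
have [ev0 ev1 Q1] := root_class_Selmer onQ.
have Q0 : 0 < root_class 0 Q by rewrite lt_neqAle eq_sym nz0 leNgt sgn0.
have [r Er] : exists r, root_class 0 Q = r ^+ 2.
  by apply: rat_squareP => // q q_pr; have [->|qp] := eqVneq q p; last exact: ev0.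
have [s Es] : exists s, P * root_class (- P) Q = s ^+ 2.
  apply: rat_squareP => [|q q_pr]; first by rewrite mulr_gt0.
  rewrite odd_valM // odd_val_p //; have [->|qp] := eqVneq q p; first by rewrite valp.
  by have [->|q2] := eqVneq q 2; [rewrite val2 | rewrite ev1].
case: Q onQ Q0 Er Q1 Es valp {sgn0 val0 val2 nz0 nz1 ev0 ev1} => [[x y]|] onQ; last first.
  by rewrite /= (odd_val_nat p 1) logn1.
rewrite /=; case: eqVneq => [_|x0].
  by rewrite expr0n mulr0 sub0r oppr_gt0 ltNge sqr_ge0.
rewrite subr0 => x_gt0 Er; case: eqVneq => [Ex|nxP].
  by move: x_gt0; rewrite Ex oppr_gt0 ltNge ltW.
rewrite opprK => xP Es _; have /on_curveE Exy := onQ.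
have r0 : r != 0 by rewrite -sqrf_eq0 -Er.
have s0 : s != 0 by rewrite -sqrf_eq0 -Es mulf_neq0 // gt_eqF.
(* From y^2 = x (x - p)(x + p), r^2 = x and s^2 = p (x + p), the square of y / (r s) is (x - p) /
   p. *)
apply: (@reflecting_of_squares p r (y / (r * s)) (s / P)); first exact: prime_gt0.
- rewrite expr_div_n exprMn -Er -Es Exy; field.
  by rewrite x0 P_neq0 gt_eqF.
- by rewrite expr_div_n -Er -Es; field.
Qed.

End Descent.

Lemma reflecting_of_rank2 (p : nat) : prime p -> p != 2 -> has_rank (E_ p) 2 ->
  reflecting_congruent_number p%:Z.
Proof.
move=> p_pr p2 [T [f [f_inj f_surj f_add]]].
have p0 : (p%:R : rat) != 0 by rewrite pnatr_eq0 -lt0n prime_gt0.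
have on_f u : on_curve (E_ p) (f u) by apply/f_surj; exists u.
have f0 : f 0 = None.
  have [u0 Eu0] := (f_surj None).1 I; have := f_add 0 u0.
  by rewrite add0r Eu0; case: (f 0) => [[]|].
(* A 2-torsion point has zero component in the torsion-free factor, so it comes from T. *)
have tors x : on_curve (E_ p) (Some (x, 0)) ->
    exists2 t : T, f (0, t) = Some (x, 0) & t + t = 0.
  move=> /f_surj[u Eu]; have : f (u + u) = f 0 by rewrite f_add Eu f0 /= oppr0 !eqxx.
  case: u Eu => v t Eu /f_inj[Ev Et]; exists t => //; rewrite -Eu; congr (f (_, _)).
  apply/rowP => j; have /rowP/(_ j) := Ev; rewrite !mxE => Evj.
  by apply/esym/eqP; move/eqP: Evj; rewrite -mulr2n mulrn_eq0.
have [t1 ft1 t1_2] : exists2 t : T, f (0, t) = Some (0, 0) & t + t = 0.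
  by apply: tors; apply/on_curveE; rewrite !expr0n mulr0 subr0.
have [t2 ft2 t2_2] : exists2 t : T, f (0, t) = Some (p%:R, 0) & t + t = 0.
  by apply: tors; apply/on_curveE; ring.
have [t3 ft3 t3_2] : exists2 t : T, f (0, t) = Some (- p%:R, 0) & t + t = 0.
  by apply: tors; apply/on_curveE; ring.
have Npp : p%:R == - p%:R :> rat = false.
  by rewrite -subr_eq0 opprK -mulr2n mulrn_eq0 (negPf p0).
have uniq_t : uniq [:: 0; t1; t2; t3].
  have neq (s t : T) : f (0, s) <> f (0, t) -> s != t.
    by move=> n; apply/eqP => E; rewrite E in n.
  have f00 : f (0, 0) = None by [].
  by rewrite /= !inE !negb_or !neq //; rewrite ?f00 ?ft1 ?ft2 ?ft3 //;
    case=> /eqP; rewrite ?Npp // eq_sym ?oppr_eq0 (negPf p0).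
have card_T2 : (4 <= #|[set t : T | t + t == 0]%R|)%N.
  rewrite cardE; apply: (uniq_leq_size uniq_t) => t.
  rewrite mem_enum !inE => /or4P[] /eqP ->; apply/eqP => //; exact: addr0.
have [u v Euv | | u Eu] :=
  surj_of_eq_mod_double (D := selmer_class p \o f) _ _ (false, false, false, true).
- have [|H /f_surj[w <-] Ew] :=
      selmer_class_half p_pr (on_f u) (on_f v) (on_f (u - v)) _ Euv.
    by rewrite -f_add subrK.
  by exists w; apply: f_inj; rewrite [RHS]f_add Ew.
(* There are 16 classes, and 2^2 times at least 4 points of 2-torsion. *)
- by rewrite !card_prod card_bool; apply: (leq_mul (leqnn 4) card_T2).
- exact: reflecting_of_selmer_class (on_f u) Eu.
Qed.

Theorem theorem1p2 (p : nat) (p_prime : prime p) (p_mod8 : p = 1 %[mod 8])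
    (p_congruent : congruent_number p)
    (hE : has_rank (E_ p) 2 \/ sha2_trivial (E_ p)) :
  reflecting_congruent_number p%:Z.
Proof.
case: hE => [rank2 | sha]; last first.
  apply: reflecting_of_coboundary => //; apply: sha.
  - exact/sqrt_cocycleP/prime_gt0.
  - exact: sqrt_cocycle_locally_trivial.
  - exact: sqrt_cocycle_double.
by apply: reflecting_of_rank2 => //; apply: contra_eq_neq p_mod8 => ->.
Qed.
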